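(* Let $T$ be a set of positive integers and $C$ a constant such that \[ |T\cap(2^j,2^{j+1}]|\le C \quad\text{for all integers } j . \] Assume that for some integer $k\ge 3$ the inequality \[ 3eCk\le 2^k \] holds, where $e$ is Euler's number. Then there exists a real $\theta\in[0,1]$ that is $2^{-k}$-regular with respect to all $t\in T$. Moreover, if $T$ is computable, then there exists a computable real $\theta$ with this property.
   Context: For a real $x$, $d(x,\mathbb{Z})$ denotes the distance from $x$ to the nearest integer. For $\varepsilon>0$ and a positive integer $t$, a real $\theta$ is $\varepsilon$-regular for (or with respect to) the denominator $t$ if $d(t\theta,\mathbb{Z})>\varepsilon$. *)

(* Defs.v *)
From mathcomp Require Import all_boot all_order all_algebra.
From mathcomp Require Import finmap.
From mathcomp Require Import all_classical all_reals all_analysis.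

Set Implicit Arguments.
Unset Strict Implicit.
Unset Printing Implicit Defensive.

Import Order.TTheory GRing.Theory Num.Theory.

Local Open Scope classical_set_scope.
Local Open Scope ring_scope.

(* Total recursive functions (Kleene): the least class of number-theoretic
   functions of all arities that contains zero, successor and the projections
   and is closed under composition, primitive recursion on the first argument,
   and minimization of regular functions, i.e. of those f such that for every
   v there is a y with f (y, v) = 0. *)
Inductive recursive : forall n : nat, (n.-tuple nat -> nat) -> Prop :=
| rec_zero : recursive (fun _ : 0.-tuple nat => 0%N)
| rec_succ : recursive (fun v : 1.-tuple nat => (thead v).+1)
| rec_proj n (i : 'I_n) : recursive (fun v : n.-tuple nat => tnth v i)
| rec_comp m n (f : m.-tuple nat -> nat) (g : 'I_m -> n.-tuple nat -> nat) :
    recursive f -> (forall i, recursive (g i)) ->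
    recursive (fun v : n.-tuple nat => f [tuple g i v | i < m])
| rec_prim n (f : n.-tuple nat -> nat) (g : n.+2.-tuple nat -> nat) :
    recursive f -> recursive g ->
    recursive (fun v : n.+1.-tuple nat =>
      iteri (thead v) (fun y r => g [tuple of y :: r :: behead v])
        (f [tuple of behead v]))
| rec_mu n (f : n.+1.-tuple nat -> nat)
    (regf : forall v : n.-tuple nat, exists y, f [tuple of y :: v] == 0%N) :
    recursive f -> recursive (fun v : n.-tuple nat => ex_minn (regf v)).

Definition computable_fun (f : nat -> nat) : Prop :=
  recursive (fun v : 1.-tuple nat => f (thead v)).

Definition computable_set (T : set nat) : Prop :=
  computable_fun (fun n => nat_of_bool `[< T n >]).

(* Rationals are coded by sign, numerator and denominator, as in Pour-El and
   Richards. *)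
Definition computable_ratseq (r : nat -> rat) : Prop :=
  exists s a b : nat -> nat,
    [/\ computable_fun s, computable_fun a, computable_fun b &
        forall n, b n != 0%N /\ r n = (-1) ^+ s n * (a n)%:R / (b n)%:R].

Definition computable_real (R : realType) (x : R) : Prop :=
  exists2 r : nat -> rat, computable_ratseq r &
    forall n, `|ratr (r n) - x| <= 2 ^- n.

Definition distZ (R : realType) (x : R) : R :=
  inf [set `|x - m%:~R| | m in [set: int]].

Definition regular (R : realType) (eps : R) (t : nat) (theta : R) : Prop :=
  eps < distZ (t%:R * theta).

(* (2^j, 2^(j+1)] for j of any sign; the number 1 lies in the block j = -1. *)
Definition dyadic_block (R : realType) (j : int) : set nat :=
  [set n | (2 : R) ^ j < n%:R <= (2 : R) ^ (j + 1)].

(* Main.v *)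
(**
Let the bad set of t be the set of points at distance less than (17/16)2^-k / t
from a multiple of 1/t, and G_i the set avoiding the bad sets of all t in T with
t 2^k <= 2^i. If a set S is a union of N intervals and has measure g, the bad set
of t meets S in measure at most (17/8)2^-k (g + N/t), and removing it adds at most
t g + N intervals. With k steps of delay between S and t, both bounds are linear
in u_i = g_i + 2^(1-i) N_i, and hence, with rho = 1 - 1/k, the potential
  L_s = g_(s+k-1) - (1/k) sum_(i < k-1) rho^(k-2-i) u_(s+i)
        - (2/(k-2)) 2^(2-s-k) N_(s+k-1)
satisfies L_(s+1) >= rho L_s; this is where 3 e C k <= 2^k is needed, as
(1 - 1/k)^(k-1) >= 1/e. Nothing is assumed on the past in this inequality, so it
holds inside any interval I. The potential is additive up to an error O(2^-s) when
I is halved, so one half always keeps L_(2n) >= 8/4^n, which forces it to meet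
G_(2n+k-1). The intervals chosen in this way shrink to theta. Computability comes
from the fact that measures are numbers of cells in a sufficiently fine grid, so
that the choice is a primitive recursive function of the characteristic function
of T. To start with a negligible N, one works in an interval of length 2^(k+3) and
reduces theta modulo 1 in the end.
*)
Require Import Defs.
From mathcomp Require Import all_boot all_order all_algebra.
From mathcomp Require Import finmap.
From mathcomp Require Import all_classical all_reals all_analysis.
From mathcomp Require Import zify ring lra.

Set Implicit Arguments.
Unset Strict Implicit.
Unset Printing Implicit Defensive.

Import Order.TTheory GRing.Theory Num.Theory.

(** * Runs of a set of integers *)

Definition card_below (S : pred nat) (l : nat) : nat :=
  \sum_(0 <= d < l) S d.

(** Each maximal run is counted at its first element, so this is the number of intervals of the set.
    The disjunct [d == 0] is there because [0.-1] is [0]. *)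
Definition runs_below (S : pred nat) (l : nat) : nat :=
  \sum_(0 <= d < l) (S d && ((d == 0) || ~~ S d.-1)).

Lemma eq_card_below (S S' : pred nat) l : S =1 S' -> card_below S l = card_below S' l.
Proof. by move=> e; apply: eq_bigr => d _; rewrite e. Qed.

Lemma eq_runs_below (S S' : pred nat) l : S =1 S' -> runs_below S l = runs_below S' l.
Proof. by move=> e; apply: eq_bigr => d _; rewrite !e. Qed.

Lemma big_nat_shift (F : nat -> nat) l m :
  \sum_(l <= i < l + m) F i = \sum_(0 <= i < m) F (l + i).
Proof.
have := big_addn 0 (l + m) l predT F (idx := 0) (op := addn).
by rewrite add0n addKn => ->; apply: eq_bigr => i _; rewrite addnC.
Qed.

Lemma card_below_add (S : pred nat) l m :
  card_below S (l + m) = card_below S l + card_below (fun d => S (l + d)) m.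
Proof.
rewrite /card_below (big_cat_nat (n := l)) ?leq_addr //=.
by rewrite big_nat_shift.
Qed.

(** Cutting at [l] divides at most one run in two. This single run is the only failure of additivity
    when an interval is halved. *)
Lemma runs_below_add (S : pred nat) l m :
  runs_below S l + runs_below (fun d => S (l + d)) m <= (runs_below S (l + m)).+1.
Proof.
rewrite /runs_below (big_cat_nat (n := l) (p := l + m)) ?leq_addr //= -addnS leq_add2l.
rewrite big_nat_shift; case: m => [|m]; first by rewrite !big_geq.
rewrite big_nat_recl // [X in (_ <= X.+1)%N]big_nat_recl //=.
have -> : \sum_(0 <= i < m) (S (l + i.+1) && ~~ S (l + i)) =
  \sum_(0 <= i < m) (S (l + i.+1) && ((l + i.+1 == 0) || ~~ S (l + i.+1).-1)).
  by apply: eq_bigr => d _; rewrite addnS.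
lia.
Qed.

(* The extra term on the left, the distance from the last multiple of P to the
   end of the current run, makes the statement inductive. *)
Lemma runs_below_dvdn_aux (S : pred nat) (P a l : nat) : 0 < P ->
  P * \sum_(0 <= d < l) (S d && (P %| d + a))
    + ((0 < l) && S l.-1) * ((l.-1 + a) %% P).+1
  <= card_below S l + P * runs_below S l.
Proof.
move=> P0; elim: l => [|l IH]; first by rewrite /card_below !big_geq // muln0.
rewrite /card_below /runs_below !big_nat_recr //= -/(card_below S l) -/(runs_below S l).
case: (S l); last by move=> /=; lia.
rewrite /= mul1n; have ltP := ltn_pmod (l + a) P0.
case: l IH ltP => [|l] /=.
  move=> _ ltP; rewrite /card_below /runs_below !big_geq // !add0n muln1.
  by rewrite /dvdn; case: eqP => h /=; move: ltP h; rewrite add0n; lia.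
case: (S l) => /= IH ltP; last first.
  by move: IH; rewrite mul0n /dvdn; case: eqP => h /=; move: ltP h; lia.
move: IH; rewrite mul1n addSn modnS; case: ifP => h /=; last lia.
suff: ((l + a) %% P).+1 = P by lia.
have := ltn_pmod (l + a) P0; rewrite leq_eqVlt => /predU1P[//|lt].
by move: h; rewrite /dvdn -addn1 -modnDml addn1 modn_small.
Qed.

(** A run of length L meets a residue class modulo [P] at most L/P + 1 times; sum over the runs. *)
Lemma runs_below_dvdn (S : pred nat) (P a l : nat) : 0 < P ->
  P * \sum_(0 <= d < l) (S d && (P %| d + a))
  <= card_below S l + P * runs_below S l.
Proof. by move=> P0; apply: leq_trans (runs_below_dvdn_aux S a l P0); rewrite leq_addr. Qed.

(** A window of [w] residues is a union of [w] residue classes, each bounded by the previous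
    lemma. *)
Lemma runs_below_window (S : pred nat) (P a w l : nat) : 0 < P -> w <= P ->
  P * \sum_(0 <= d < l) (S d && ((d + a) %% P < w))
  <= w * (card_below S l + P * runs_below S l).
Proof.
move=> P0; elim: w => [_|w IH wP].
  by rewrite mul0n big1 ?muln0 // => d _; rewrite ltn0 andbF.
have {}IH := IH (ltnW wP).
(* Adding [P - w] moves the residue [w] to 0. *)
have := runs_below_dvdn S (a + (P - w)) l P0.
have -> : \sum_(0 <= d < l) (S d && ((d + a) %% P < w.+1)) =
  \sum_(0 <= d < l) (S d && ((d + a) %% P < w)) +
  \sum_(0 <= d < l) (S d && (P %| d + (a + (P - w)))).
  rewrite -big_split; apply: eq_bigr => d _ /=; case: (S d) => //=.
  have -> : (P %| d + (a + (P - w))) = ((d + a) %% P == w).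
    rewrite addnA -[X in _ = (_ == X)](modn_small wP) -(eqn_modDr (P - w)).
    by rewrite (subnKC (ltnW wP)) modnn.
  by rewrite ltnS leq_eqVlt; case: (ltngtP ((d + a) %% P) w).
lia.
Qed.

Lemma card_below_scale (S : pred nat) r l : 0 < r ->
  card_below (fun d => S (d %/ r)) (r * l) = r * card_below S l.
Proof.
move=> r0; elim: l => [|l IH]; first by rewrite muln0 /card_below !big_geq // muln0.
rewrite mulnS addnC card_below_add IH [in RHS]/card_below big_nat_recr //= mulnDr.
congr addn; rewrite /card_below.
rewrite (eq_big_nat _ _ (F2 := fun=> nat_of_bool (S l))); last first.
  by move=> d /andP[_ dr]; rewrite mulnC divnMDl // divn_small // addn0.
by rewrite sum_nat_const_nat subn0.
Qed.

(** Cutting every cell into [r] cells leaves the underlying union of intervals as it is, hence also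
    their number. *)
Lemma runs_below_scale (S : pred nat) r l : 0 < r ->
  runs_below (fun d => S (d %/ r)) (r * l) = runs_below S l.
Proof.
move=> r0; elim: l => [|l IH]; first by rewrite muln0 /runs_below !big_geq.
rewrite [in RHS]/runs_below big_nat_recr //= -/(runs_below S l) -IH.
rewrite /runs_below mulnS addnC (big_cat_nat (n := r * l)) ?leq_addr //=; congr addn.
(* Of the [r] subcells of a cell only the first can start a run. *)
rewrite big_ltn; last by rewrite -[ltnLHS]addn0 ltn_add2l.
rewrite mulKn // muln_eq0 [r == 0]eqn0Ngt r0 /=.
rewrite big_nat big1 ?addn0 => [|d /andP[dl dr]].
  case: l {IH} => [|l]; first by rewrite !orTb.
  have -> // : (r * l.+1).-1 %/ r = l.
  rewrite mulnS; case: r r0 => // r _; rewrite addSn /= addnC mulnC.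
  by rewrite divnMDl // divn_small // addn0.
have h e : r * l <= e < r * l + r -> e %/ r = l.
  move=> ?; have -> : e = l * r + (e - r * l) by lia.
  by rewrite divnMDl // divn_small ?addn0 //; lia.
rewrite !h; [|lia|lia].
by have -> : d == 0 = false by [lia]; case: (S l).
Qed.

(** * Grid cells *)

(* The unit interval is divided into 2^(k+4) F cells; when t divides F, the
   cell c is bad for t iff it lies in a (17/16)2^-k / t - neighbourhood of a
   multiple of 1/t. *)
Definition bad_cell (k F t c : nat) : bool :=
  (t * c + 17 * F) %% (2 ^ (k + 4) * F) < 34 * F.

(** As [t * 2 ^ k <= 2 ^ i] implies [t <= 2 ^ i], a finite search suffices, which makes the test
    primitive recursive in [T]. *)
Definition free_cell (T : pred nat) (k F i c : nat) : bool :=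
  all (fun t => ~~ [&& T t, t * 2 ^ k <= 2 ^ i & bad_cell k F t c])
    (iota 0 (2 ^ i).+1).

(** These are the t whose bad sets are removed between stages [j] and [j.+1]. They form the dyadic
    block of index j - k, multiplied out to avoid negative exponents. *)
Definition in_block (k j t : nat) : bool := 2 ^ j < t * 2 ^ k <= 2 ^ j.+1.

Definition cells (T : pred nat) (k F i x : nat) : pred nat :=
  fun d => free_cell T k F i (x + d).

Definition block_card (T : pred nat) (k j : nat) : nat :=
  \sum_(0 <= t < (2 ^ j.+1).+1) (T t && in_block k j t).

Lemma free_cellP (T : pred nat) (k F i c : nat) :
  reflect (forall t, T t -> t * 2 ^ k <= 2 ^ i -> ~~ bad_cell k F t c)
          (free_cell T k F i c).
Proof.
apply: (iffP allP) => [h t Tt ti|h t _].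
  have := h t; rewrite mem_iota /= add0n ltnS Tt ti /=; apply.
  by apply: leq_trans ti; rewrite leq_pmulr // expn_gt0.
by apply/negP => /and3P[Tt ti]; apply/negP/h.
Qed.

Lemma bad_cell_period (k F' t c : nat) : 0 < t ->
  bad_cell k (t * F') t c = ((c + 17 * F') %% (2 ^ (k + 4) * F') < 34 * F').
Proof.
move=> t0; rewrite /bad_cell.
have -> : t * c + 17 * (t * F') = t * (c + 17 * F') by ring.
have -> : 2 ^ (k + 4) * (t * F') = t * (2 ^ (k + 4) * F') by ring.
have -> : 34 * (t * F') = t * (34 * F') by ring.
by rewrite -muln_modr ltn_pmul2l.
Qed.

(** When [t] divides [F], the ends of the bad intervals of [t] are grid points, so all subcells of a
    cell have its status. *)
Lemma bad_cell_scale (k F r t c : nat) : 0 < r -> 0 < t -> t %| F ->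
  bad_cell k (r * F) t c = bad_cell k F t (c %/ r).
Proof.
move=> r0 t0 /dvdnP[F' ->]; rewrite (mulnC F').
have -> : r * (t * F') = t * (r * F') by ring.
rewrite !bad_cell_period // [in LHS](divn_eq c r).
have -> : c %/ r * r + c %% r + 17 * (r * F') = (c %/ r + 17 * F') * r + c %% r by ring.
set z := c %/ r + 17 * F'; set P := 2 ^ (k + 4) * F'.
have -> : 2 ^ (k + 4) * (r * F') = P * r by rewrite /P; ring.
have -> : 34 * (r * F') = 34 * F' * r by ring.
have cr := ltn_pmod c r0.
have [->|P0] := posnP P; first by rewrite mul0n !modn0; nia.
have lt := ltn_pmod z P0.
rewrite [in LHS](divn_eq z P) mulnDl -mulnA -addnA modnMDl modn_small; nia.
Qed.

Lemma free_cell_scale (T : pred nat) (k F r i c : nat) : 0 < r -> ~~ T 0 ->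
  (forall t, 0 < t <= 2 ^ i -> t %| F) ->
  free_cell T k (r * F) i c = free_cell T k F i (c %/ r).
Proof.
move=> r0 T0 hF; apply/free_cellP/free_cellP => h t Tt ti; have := h _ Tt ti;
  (have t0 : 0 < t by case: t Tt {ti} => //; rewrite (negPf T0));
  rewrite bad_cell_scale ?hF // t0 /=;
  by apply: leq_trans ti; rewrite leq_pmulr // expn_gt0.
Qed.

Lemma free_cell_mono (T : pred nat) (k F i j c : nat) : i <= j ->
  free_cell T k F j c -> free_cell T k F i c.
Proof.
move=> ij /free_cellP h; apply/free_cellP => t Tt ti; apply: h => //.
by apply: leq_trans ti _; rewrite leq_exp2l.
Qed.

Lemma free_cellS_neg (T : pred nat) (k F j c : nat) :
  free_cell T k F j c -> ~~ free_cell T k F j.+1 c ->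
  exists2 t, t < (2 ^ j.+1).+1 & T t && in_block k j t && bad_cell k F t c.
Proof.
move=> /free_cellP h /allPn[t]; rewrite mem_iota add0n /= => tj.
rewrite negbK => /and3P[Tt ti bt]; exists t => //; rewrite Tt bt andbT /=.
rewrite /in_block ti andbT ltnNge; apply/negP => tj'.
by have := h t Tt tj'; rewrite bt.
Qed.

Lemma leq_sum_term (n t : nat) (f : nat -> nat) : t < n -> f t <= \sum_(0 <= i < n) f i.
Proof. by move=> tn; rewrite big_mkord (bigD1 (Ordinal tn)) //= leq_addr. Qed.

(** * Effect of removing one dyadic block *)

Section BlockStep.

Variables (T : pred nat) (k F j s x l : nat).
Hypotheses (sj : s <= j) (k2 : 1 < k) (F0 : 0 < F).
Hypothesis dvdF : forall t, 0 < t <= 2 ^ j.+1 -> t %| F.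

Let Q := 2 ^ (k + 4) * F.
Let S i := cells T k F i x.
Let blk t := T t && in_block k j t.

Let in_block_div t : in_block k j t -> [/\ 0 < t, t %| F & 0 < F %/ t].
Proof.
move=> /andP[tl tr].
have t0 : 0 < t by case: t tl {tr} => //; rewrite mul0n.
have tF : t %| F.
  by apply: dvdF; rewrite t0 (leq_trans _ tr) // leq_pmulr // expn_gt0.
by split=> //; rewrite divn_gt0 // dvdn_leq.
Qed.

(** A lost cell is bad for some t of the block. It is counted in the earlier and larger set [S s],
    whose number of runs is still small compared with the period of the bad sets. *)
Lemma card_block_step :
  card_below (S j) l <= card_below (S j.+1) l +
    \sum_(0 <= t < (2 ^ j.+1).+1 | blk t)
      \sum_(0 <= d < l) (S s d && bad_cell k F t (x + d)).
Proof.
rewrite exchange_big /= -big_split; apply: leq_sum => d _ /=.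
have [Sj|] := boolP (S j d) => //; have [//|nSj /=] := boolP (S j.+1 d).
have [t tj /andP[bt badt]] := free_cellS_neg Sj nSj.
rewrite add0n big_mkcond /= (leq_trans _ (leq_sum_term _ tj)) //= /blk bt badt andbT.
by rewrite lt0b; apply: free_cell_mono Sj.
Qed.

(** A run of [S j.+1] that starts where no run of [S j] starts follows a removed cell, so it begins
    at the right end of a bad interval of some t in the block. The divisibility expresses that
    [x + d] is such a right end. *)
Lemma runs_block_step :
  runs_below (S j.+1) l <= runs_below (S j) l +
    \sum_(0 <= t < (2 ^ j.+1).+1 | blk t)
      \sum_(0 <= d < l)
        (S s d && (Q %/ t %| d + (x + 17 * (F %/ t) + (Q %/ t - 34 * (F %/ t))))).
Proof.
rewrite exchange_big /= -big_split; apply: leq_sum => d _ /=.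
have [Sj1 /=|//] := boolP (S j.+1 d).
have Sj : S j d by apply: free_cell_mono Sj1.
rewrite Sj; case: d Sj1 Sj => [//|d] Sj1 Sj /=.
have [Sj' /=|_] := boolP (S j d); last by case: (S j.+1 d).
have [//|nSj /=] := boolP (S j.+1 d).
have [t tj /andP[bt badt]] := free_cellS_neg Sj' nSj.
rewrite add0n big_mkcond /= (leq_trans _ (leq_sum_term _ tj)) //= /blk bt lt0b.
have -> /= : S s d.+1 by apply: free_cell_mono Sj.
have [t0 /dvdnP[F' eF] Ft] := in_block_div (proj2 (andP bt)).
have ngd : ~~ bad_cell k F t (x + d.+1).
  by move/free_cellP: Sj1; apply; [case/andP: bt|case/and3P: bt].
move: badt ngd; rewrite /Q eF mulnK // !(mulnC F') !bad_cell_period //.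
have F'0 : 0 < F' by move: Ft; rewrite eF mulnK.
have -> : 2 ^ (k + 4) * (t * F') = 2 ^ (k + 4) * F' * t by ring.
rewrite mulnK //; set P := 2 ^ (k + 4) * F'.
have P34 : 34 * F' < P.
  rewrite ltn_pmul2r // (leq_trans (_ : 34 < 2 ^ 6)) // leq_exp2l //; lia.
set z := x + d + 17 * F'.
have -> : x + d.+1 + 17 * F' = z.+1 by rewrite /z; lia.
have -> : d.+1 + (x + 17 * F' + (P - 34 * F')) = z.+1 + (P - 34 * F') by rewrite /z; lia.
(* From [z] to [z.+1] the residue wraps to 0, which would make the next cell bad, or grows by one;
   it then crosses [34 * F'] exactly. *)
rewrite modnS; case: ifP => [_|h zlt]; first by rewrite muln_gt0 F'0.
rewrite -leqNgt => zge.
have e : (z %% P).+1 = 34 * F' by lia.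
rewrite /dvdn -modnDml modnS h e subnKC ?modnn //; lia.
Qed.

(** The bad set of [t] has period [Q %/ t] and density 34 / 2^(k+4) = (17/8) 2^-k, so the window
    bound applies. *)
Lemma bad_block_bound t : in_block k j t ->
  2 ^ (k + 4) * \sum_(0 <= d < l) (S s d && bad_cell k F t (x + d))
  <= 34 * (card_below (S s) l + Q %/ t * runs_below (S s) l).
Proof.
move=> bt; have [t0 /dvdnP[F' eF] Ft] := in_block_div bt.
have F'0 : 0 < F' by move: Ft; rewrite eF mulnK.
have -> : Q %/ t = 2 ^ (k + 4) * F' by rewrite /Q eF mulnA mulnK.
set P := 2 ^ (k + 4) * F'.
have P34 : 34 * F' <= P.
  rewrite leq_pmul2r // (leq_trans (_ : 34 <= 2 ^ 6)) // leq_exp2l //.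
  by rewrite -[6]/(2 + 4) leq_add2r.
have P0 : 0 < P by rewrite muln_gt0 expn_gt0.
have -> : \sum_(0 <= d < l) (S s d && bad_cell k F t (x + d)) =
  \sum_(0 <= d < l) (S s d && ((d + (x + 17 * F')) %% P < 34 * F')).
  apply: eq_bigr => d _; rewrite eF mulnC bad_cell_period // -/P.
  by rewrite (addnC x d) addnA.
rewrite -(leq_pmul2r F'0) mulnAC -/P [leqRHS]mulnAC.
exact: runs_below_window.
Qed.

Lemma end_block_bound t : in_block k j t ->
  Q %/ t * \sum_(0 <= d < l)
        (S s d && (Q %/ t %| d + (x + 17 * (F %/ t) + (Q %/ t - 34 * (F %/ t)))))
  <= card_below (S s) l + Q %/ t * runs_below (S s) l.
Proof.
move=> bt; have [t0 tF Ft] := in_block_div bt.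
apply: runs_below_dvdn; rewrite divn_gt0 // dvdn_leq ?dvdn_mull //.
by rewrite muln_gt0 expn_gt0.
Qed.

End BlockStep.

(** * Integer form of the potential and choice of the intervals *)

Definition cell_card (T : pred nat) (k F x l i : nat) : nat :=
  card_below (cells T k F i x) l.

Definition cell_runs (T : pred nat) (k F x l i : nat) : nat :=
  runs_below (cells T k F i x) l.

Definition cells_per_unit (k F : nat) : nat := 2 ^ (k + 4) * F.

(* The inequality 8 Q / 2^s <= potential K Q s g N cleared of denominators. *)
Definition potential_test (K Q s : nat) (g N : nat -> nat) : bool :=
  K.-1 * (\sum_(0 <= i < K) K ^ (K.-1 - i) * K.+1 ^ i *
      (2 ^ (s + K) * g (s + i) + 2 ^ (K.+1 - i) * Q * N (s + i)))
   + 4 * K.+1 ^ K * Q * N (s + K) + K.-1 * K.+1 ^ K * 2 ^ (K + 3) * Q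
   <= K.-1 * K.+1 ^ K * 2 ^ (s + K) * g (s + K).

(** The potential at 2n looks as far as stage 2n + K. The factorial is divisible by every t that can
    be active there. *)
Definition stage_fact (K n : nat) : nat := (2 ^ (n.*2 + K))`!.
Definition stage_F (K n : nat) : nat := 2 ^ n * stage_fact K n.
(** The number of cells in length 2^(K+4-n); the factor [2 ^ n] in [stage_F] makes it an integer. *)
Definition stage_len (K n : nat) : nat :=
  2 ^ (K + 4) * 2 ^ (K.+1 + 4) * stage_fact K n.

(** It serves both as the test on a left half and, for the chosen interval, as the invariant of the
    construction. *)
Definition left_ok (T : pred nat) (K n m : nat) : bool :=
  potential_test K (cells_per_unit K.+1 (stage_F K n)) n.*2
    (cell_card T K.+1 (stage_F K n) (m * stage_len K n) (stage_len K n))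
    (cell_runs T K.+1 (stage_F K n) (m * stage_len K n) (stage_len K n)).

(* The n-th interval is [m, m + 1] * 2^(K + 4 - n) with m = digits T K n. *)
Definition digits (T : pred nat) (K n : nat) : nat :=
  iteri n (fun i m => 2 * m + ~~ left_ok T K i.+1 (2 * m)) 0.

(** * Recursive functions *)

(* Working with functions of an argument list lets a bound variable be pushed
   on the list, the variable number i of the context s being nth 0 s i. *)
Definition recs (n : nat) (f : seq nat -> nat) : Prop :=
  recursive (fun v : n.-tuple nat => f v).

Fixpoint all_recs (n : nat) (gs : seq (seq nat -> nat)) : Prop :=
  if gs is g :: gs' then recs n g /\ all_recs n gs' else True.

Lemma eq_recs n (f g : seq nat -> nat) :
  (forall s, size s = n -> f s = g s) -> recs n f -> recs n g.
Proof.
move=> e; rewrite /recs; congr (recursive _).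
by apply/funext => v; rewrite e // size_tuple.
Qed.

Lemma all_recs_nth n gs i : all_recs n gs -> i < size gs ->
  recs n (nth (fun=> 0) gs i).
Proof. by elim: gs i => // g gs IH [|i] /= [hg hgs]; [|rewrite ltnS; apply: IH]. Qed.

Lemma recs_comp n (gs : seq (seq nat -> nat)) f :
  recs (size gs) f -> all_recs n gs -> recs n (fun s => f [seq g s | g <- gs]).
Proof.
move=> hf hgs.
have := rec_comp (g := fun i (v : n.-tuple nat) => nth (fun=> 0) gs i v) hf.
move=> /(_ (fun i => all_recs_nth hgs (ltn_ord i))); congr (recursive _).
apply/funext => v; congr f.
apply: (@eq_from_nth _ 0) => [|i]; rewrite size_tuple ?size_map // => igs.
by rewrite -(tnth_nth 0 _ (Ordinal igs)) tnth_mktuple (nth_map (fun=> 0)).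
Qed.

Lemma recs_var n i : i < n -> recs n (fun s => nth 0 s i).
Proof.
move=> ni; have := rec_proj (Ordinal ni); congr (recursive _).
by apply/funext => v; rewrite (tnth_nth 0).
Qed.

Lemma all_recs_vars n m p : m + p <= n ->
  all_recs n [seq (fun s => nth 0 s i) | i <- iota m p].
Proof.
elim: p m => //= p IH m mp; split; first by apply: recs_var; lia.
by apply: IH; lia.
Qed.

Lemma map_vars s m p : m + p = size s ->
  [seq g s | g <- [seq (fun s => nth 0 s i) | i <- iota m p]] = drop m s.
Proof.
move=> e; rewrite -map_comp.
apply: (@eq_from_nth _ 0) => [|i]; rewrite size_map size_iota.
  by rewrite size_drop -e addKn.
by move=> ip; rewrite (nth_map 0) ?size_iota // nth_iota // nth_drop.
Qed.

Lemma recs_comp1 n f g : recs 1 (fun s => f (nth 0 s 0)) ->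
  recs n g -> recs n (fun s => f (g s)).
Proof. by move=> hf hg; apply: (recs_comp (gs := [:: g]) hf). Qed.

Lemma recs_comp2 n f g1 g2 : recs 2 (fun s => f (nth 0 s 0) (nth 0 s 1)) ->
  recs n g1 -> recs n g2 -> recs n (fun s => f (g1 s) (g2 s)).
Proof. by move=> hf h1 h2; apply: (recs_comp (gs := [:: g1; g2]) hf). Qed.

Lemma recs_comp3 n f g1 g2 g3 :
  recs 3 (fun s => f (nth 0 s 0) (nth 0 s 1) (nth 0 s 2)) ->
  recs n g1 -> recs n g2 -> recs n g3 -> recs n (fun s => f (g1 s) (g2 s) (g3 s)).
Proof. by move=> hf h1 h2 h3; apply: (recs_comp (gs := [:: g1; g2; g3]) hf). Qed.

Lemma recs_comp4 n f g1 g2 g3 g4 :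
  recs 4 (fun s => f (nth 0 s 0) (nth 0 s 1) (nth 0 s 2) (nth 0 s 3)) ->
  recs n g1 -> recs n g2 -> recs n g3 -> recs n g4 ->
  recs n (fun s => f (g1 s) (g2 s) (g3 s) (g4 s)).
Proof. by move=> hf h1 h2 h3 h4; apply: (recs_comp (gs := [:: g1; g2; g3; g4]) hf). Qed.

Lemma recs_succ n f : recs n f -> recs n (fun s => (f s).+1).
Proof.
apply: (recs_comp1 (f := S)); have := rec_succ; congr (recursive _).
by apply/funext => v; rewrite /thead (tnth_nth 0).
Qed.

Lemma recs_const n c : recs n (fun=> c).
Proof.
elim: c => [|c IH]; last exact: recs_succ IH.
exact: (recs_comp (gs := [::]) (f := fun=> 0) rec_zero).
Qed.

Lemma recs_iteri n b f g : recs n b -> recs n f -> recs n.+2 g ->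
  recs n (fun s => iteri (b s) (fun y r => g (y :: r :: s)) (f s)).
Proof.
move=> hb hf hg.
have h : recs n.+1 (fun s => iteri (head 0 s)
    (fun y r => g (y :: r :: behead s)) (f (behead s))).
  have := rec_prim hf hg; congr (recursive _); apply/funext => v.
  by case/tupleP: v => a v; rewrite theadE.
(* Primitive recursion counts up to its first argument; composition with [b] and the variables
   allows any bound computed from the context. *)
pose gs := b :: [seq (fun s => nth 0 s i) | i <- iota 0 n].
have sgs : size gs = n.+1 by rewrite /= size_map size_iota.
rewrite -sgs in h; have := recs_comp (n := n) h.
move=> /(_ (conj hb (@all_recs_vars n 0 n (leqnn n)))); apply: eq_recs => s sn.
by rewrite /= map_vars ?drop0.
Qed.

Lemma recs_add n f g : recs n f -> recs n g -> recs n (fun s => f s + g s).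
Proof.
apply: recs_comp2.
apply: (@eq_recs _ (fun s => iteri (nth 0 s 1) (fun y r => r.+1) (nth 0 s 0))).
  by move=> s _; elim: (nth 0 s 1) => [|m IH] /=; rewrite ?addn0 // IH addnS.
apply: (recs_iteri (g := fun s => (nth 0 s 1).+1)); try exact: recs_var.
by apply: recs_succ; exact: recs_var.
Qed.

Lemma recs_mul n f g : recs n f -> recs n g -> recs n (fun s => f s * g s).
Proof.
apply: recs_comp2.
apply: (@eq_recs _ (fun s => iteri (nth 0 s 1) (fun y r => r + nth 0 s 0) 0)).
  by move=> s _; elim: (nth 0 s 1) => [|m IH] /=; rewrite ?muln0 // IH mulnS addnC.
apply: (recs_iteri (g := fun s => nth 0 s 1 + nth 0 s 2)); try exact: recs_var.
  exact: recs_const.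
by apply: recs_add; exact: recs_var.
Qed.

Lemma recs_exp n f g : recs n f -> recs n g -> recs n (fun s => f s ^ g s).
Proof.
apply: recs_comp2.
apply: (@eq_recs _ (fun s => iteri (nth 0 s 1) (fun y r => r * nth 0 s 0) 1)).
  by move=> s _; elim: (nth 0 s 1) => [|m IH] //=; rewrite IH expnSr.
apply: (recs_iteri (g := fun s => nth 0 s 1 * nth 0 s 2)); try exact: recs_var.
  exact: recs_const.
by apply: recs_mul; exact: recs_var.
Qed.

Lemma recs_fact n f : recs n f -> recs n (fun s => (f s)`!).
Proof.
apply: recs_comp1.
apply: (@eq_recs _ (fun s => iteri (nth 0 s 0) (fun y r => y.+1 * r) 1)).
  by move=> s _; elim: (nth 0 s 0) => [|m IH] //=; rewrite IH factS.
apply: (recs_iteri (g := fun s => (nth 0 s 0).+1 * nth 0 s 1)); try exact: recs_var.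
  exact: recs_const.
by apply: recs_mul; [apply: recs_succ|]; exact: recs_var.
Qed.

Lemma recs_pred n f : recs n f -> recs n (fun s => (f s).-1).
Proof.
apply: recs_comp1.
apply: (@eq_recs _ (fun s => iteri (nth 0 s 0) (fun y r => y) 0)).
  by move=> s _; case: (nth 0 s 0).
apply: (recs_iteri (g := fun s => nth 0 s 0)); try exact: recs_var.
exact: recs_const.
Qed.

Lemma recs_sub n f g : recs n f -> recs n g -> recs n (fun s => f s - g s).
Proof.
apply: recs_comp2.
apply: (@eq_recs _ (fun s => iteri (nth 0 s 1) (fun y r => r.-1) (nth 0 s 0))).
  by move=> s _; elim: (nth 0 s 1) => [|m IH] /=; rewrite ?subn0 // IH subnS.
apply: (recs_iteri (g := fun s => (nth 0 s 1).-1)); try exact: recs_var.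
by apply: recs_pred; exact: recs_var.
Qed.

Lemma recs_sum n b h : recs n b -> recs n.+1 h ->
  recs n (fun s => \sum_(0 <= i < b s) h (i :: s)).
Proof.
move=> hb hh.
apply: (@eq_recs _ (fun s => iteri (b s) (fun y r => r + h (y :: s)) 0)).
  move=> s _; elim: (b s) => [|m IH] /=; first by rewrite big_geq.
  by rewrite big_nat_recr //= IH.
(* The recursion works in the context y :: r :: s. This substitution drops the accumulator r, which
   the summand does not see. *)
pose gs := (fun s => nth 0 s 0) :: [seq (fun s => nth 0 s i) | i <- iota 2 n].
have sgs : size gs = n.+1 by rewrite /= size_map size_iota.
rewrite -sgs in hh; have := recs_comp (n := n.+2) hh.
move=> /(_ (conj (recs_var (ltn0Sn _)) (@all_recs_vars n.+2 2 n (leqnn n.+2)))) hh'.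
apply: (@eq_recs _ (fun s => iteri (b s)
    (fun y r => (fun s' => nth 0 s' 1 + h [seq g s' | g <- gs]) [:: y, r & s]) 0)).
  move=> s sn; apply: eq_iteri => y r /=; congr (r + h (y :: _)).
  by rewrite map_vars /= ?drop0 ?sn.
apply: (recs_iteri (g := fun s' => nth 0 s' 1 + h [seq g s' | g <- gs]) hb).
  exact: recs_const.
by apply: recs_add => //; exact: recs_var.
Qed.

Lemma recs_negb n (f : seq nat -> bool) :
  recs n (fun s => f s) -> recs n (fun s => ~~ f s).
Proof.
move=> hf; apply: (@eq_recs _ (fun s => 1 - f s)); first by move=> s _; case: (f s).
by apply: recs_sub hf; exact: recs_const.
Qed.

Lemma recs_andb n (f g : seq nat -> bool) :
  recs n (fun s => f s) -> recs n (fun s => g s) -> recs n (fun s => f s && g s).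
Proof.
move=> hf hg; apply: (@eq_recs _ (fun s => f s * g s)); last exact: recs_mul.
by move=> s _; rewrite mulnb.
Qed.

Lemma recs_orb n (f g : seq nat -> bool) :
  recs n (fun s => f s) -> recs n (fun s => g s) -> recs n (fun s => f s || g s).
Proof.
move=> hf hg; apply: (@eq_recs _ (fun s => ~~ (~~ f s && ~~ g s))).
  by move=> s _; rewrite negb_and !negbK.
by apply: recs_negb; apply: recs_andb; apply: recs_negb.
Qed.

Lemma recs_leq n f g : recs n f -> recs n g -> recs n (fun s => f s <= g s).
Proof.
move=> hf hg; apply: (@eq_recs _ (fun s => 1 - (f s - g s))).
  by move=> s _; lia.
by apply: recs_sub; [exact: recs_const|exact: recs_sub].
Qed.

Lemma recs_eq n (f g : seq nat -> nat) :
  recs n f -> recs n g -> recs n (fun s => f s == g s).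
Proof.
move=> hf hg; apply: (@eq_recs _ (fun s => (f s <= g s) && (g s <= f s))).
  by move=> s _; rewrite eqn_leq.
by apply: recs_andb; exact: recs_leq.
Qed.

Lemma recs_all n b (h : seq nat -> bool) : recs n b -> recs n.+1 (fun s => h s) ->
  recs n (fun s => all (fun i => h (i :: s)) (iota 0 (b s))).
Proof.
move=> hb hh.
apply: (@eq_recs _ (fun s => (\sum_(0 <= i < b s) ~~ h (i :: s)) == 0)).
  move=> s _; rewrite sum_nat_seq_eq0 /index_iota subn0.
  by congr nat_of_bool; apply: eq_all => i; rewrite eqb0 negbK.
apply: recs_eq; last exact: recs_const.
by apply: (recs_sum (h := fun s => ~~ h s)) => //; exact: recs_negb.
Qed.

Lemma recs_div n f g : recs n f -> recs n g -> recs n (fun s => f s %/ g s).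
Proof.
apply: recs_comp2.
(* The quotient is the number of positive multiples of the divisor up to the dividend. The first
   factor gives the conventional value 0 for division by zero. *)
apply: (@eq_recs _ (fun s => (0 < nth 0 s 1) *
    \sum_(0 <= i < nth 0 s 0) (i.+1 * nth 0 s 1 <= nth 0 s 0))).
  move=> s _; move: (nth 0 s 0) (nth 0 s 1) => m [|d]; first by rewrite divn0.
  rewrite mul1n.
  rewrite (eq_bigr (fun i => nat_of_bool (i < m %/ d.+1))); last first.
    by move=> i _; rewrite leq_divRL.
  rewrite (big_cat_nat (n := m %/ d.+1)) ?leq_div //= addnC.
  rewrite big_nat big1 => [|i /andP[qi _]]; last by rewrite ltnNge qi.
  rewrite (eq_big_nat _ _ (F2 := fun=> 1)) => [|i /andP[_ ->] //].
  by rewrite sum_nat_const_nat muln1 subn0.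
apply: recs_mul; first by apply: recs_leq; [exact: recs_const|exact: recs_var].
apply: (recs_sum (h := fun s => (nth 0 s 0).+1 * nth 0 s 2 <= nth 0 s 1)).
  exact: recs_var.
apply: recs_leq; last exact: recs_var.
by apply: recs_mul; [apply: recs_succ|]; exact: recs_var.
Qed.

Lemma recs_mod n f g : recs n f -> recs n g -> recs n (fun s => f s %% g s).
Proof.
move=> hf hg; apply: (@eq_recs _ (fun s => f s - f s %/ g s * g s)).
  by move=> s _; rewrite {1}(divn_eq (f s) (g s)) addKn.
by apply: recs_sub => //; apply: recs_mul => //; exact: recs_div.
Qed.

Lemma computable_funE (f : nat -> nat) :
  computable_fun f <-> recs 1 (fun s => f (nth 0 s 0)).
Proof.
rewrite /computable_fun /recs.
suff -> : (fun v : 1.-tuple nat => f (thead v)) = (fun v => f (nth 0 v 0)) by [].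
by apply/funext => v; rewrite /thead (tnth_nth 0).
Qed.

Lemma recs_double n f : recs n f -> recs n (fun s => (f s).*2).
Proof.
move=> hf; apply: (@eq_recs _ (fun s => 2 * f s)); first by move=> s _; rewrite mul2n.
by apply: recs_mul => //; exact: recs_const.
Qed.

(** Recursion on the syntax of the body; applications of other functions are left as goals. *)
Ltac solve_recs :=
  repeat (try assumption; lazymatch goal with
    | |- recs _ (fun _ => ?c) => refine (recs_const _ _)
    | |- recs _ (fun s => nth 0 s _) => refine (recs_var _); done
    | |- recs _ (fun s => S _) => refine (recs_succ _)
    | |- recs _ (fun s => predn _) => refine (recs_pred _)
    | |- recs _ (fun s => double _) => refine (recs_double _)
    | |- recs _ (fun s => addn _ _) => refine (recs_add _ _)
    | |- recs _ (fun s => muln _ _) => refine (recs_mul _ _)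
    | |- recs _ (fun s => subn _ _) => refine (recs_sub _ _)
    | |- recs _ (fun s => expn _ _) => refine (recs_exp _ _)
    | |- recs _ (fun s => factorial _) => refine (recs_fact _)
    | |- recs _ (fun s => modn _ _) => refine (recs_mod _ _)
    | |- recs _ (fun s => nat_of_bool (~~ _)) => refine (recs_negb _)
    | |- recs _ (fun s => nat_of_bool (_ && _)) => refine (recs_andb _ _)
    | |- recs _ (fun s => nat_of_bool (_ || _)) => refine (recs_orb _ _)
    | |- recs _ (fun s => nat_of_bool (leq _ _)) => refine (recs_leq _ _)
    | |- recs _ (fun s => nat_of_bool (_ == _)) => refine (recs_eq _ _)
    end).

(** * Computability of the digits *)

Section ComputableDigits.

Variables (T : pred nat) (K : nat).
Hypothesis recT : recs 1 (fun s => T (nth 0 s 0)).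

Let k := K.+1.

Lemma recs_bad_cell n f1 f2 f3 : recs n f1 -> recs n f2 -> recs n f3 ->
  recs n (fun s => bad_cell k (f1 s) (f2 s) (f3 s)).
Proof. by apply: (recs_comp3 (f := bad_cell k)); rewrite /bad_cell; solve_recs. Qed.

Lemma recs_free_cell n f1 f2 f3 : recs n f1 -> recs n f2 -> recs n f3 ->
  recs n (fun s => free_cell T k (f1 s) (f2 s) (f3 s)).
Proof.
apply: (recs_comp3 (f := free_cell T k)).
apply: (recs_all (h := fun s => ~~ [&& T (nth 0 s 0),
  nth 0 s 0 * 2 ^ k <= 2 ^ (nth 0 s 2) & bad_cell k (nth 0 s 1) (nth 0 s 0) (nth 0 s 3)])).
  by solve_recs.
solve_recs; last by apply: recs_bad_cell; solve_recs.
by apply: (recs_comp1 (f := fun t => T t) recT); solve_recs.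
Qed.

Lemma recs_cell_card n f1 f2 f3 f4 : recs n f1 -> recs n f2 -> recs n f3 -> recs n f4 ->
  recs n (fun s => cell_card T k (f1 s) (f2 s) (f3 s) (f4 s)).
Proof.
apply: (recs_comp4 (f := cell_card T k)); apply: (recs_sum (h := fun s =>
  free_cell T k (nth 0 s 1) (nth 0 s 4) (nth 0 s 2 + nth 0 s 0))).
  by solve_recs.
by apply: recs_free_cell; solve_recs.
Qed.

Lemma recs_cell_runs n f1 f2 f3 f4 : recs n f1 -> recs n f2 -> recs n f3 -> recs n f4 ->
  recs n (fun s => cell_runs T k (f1 s) (f2 s) (f3 s) (f4 s)).
Proof.
apply: (recs_comp4 (f := cell_runs T k)); apply: (recs_sum (h := fun s =>
  free_cell T k (nth 0 s 1) (nth 0 s 4) (nth 0 s 2 + nth 0 s 0) &&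
  ((nth 0 s 0 == 0) ||
   ~~ free_cell T k (nth 0 s 1) (nth 0 s 4) (nth 0 s 2 + (nth 0 s 0).-1)))).
  by solve_recs.
by solve_recs; apply: recs_free_cell; solve_recs.
Qed.

Lemma recs_stage_fact n f : recs n f -> recs n (fun s => stage_fact K (f s)).
Proof.
by move=> hf; rewrite /stage_fact; solve_recs.
Qed.

Lemma recs_stage_F n f : recs n f -> recs n (fun s => stage_F K (f s)).
Proof. by move=> hf; rewrite /stage_F; solve_recs; apply: recs_stage_fact. Qed.

Lemma recs_stage_len n f : recs n f -> recs n (fun s => stage_len K (f s)).
Proof. by move=> hf; rewrite /stage_len; solve_recs; apply: recs_stage_fact. Qed.

Lemma recs_left_ok n f1 f2 : recs n f1 -> recs n f2 ->
  recs n (fun s => left_ok T K (f1 s) (f2 s)).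
Proof.
apply: (recs_comp2 (f := left_ok T K)).
(* Inside the sum the index is variable 0, so n and m become variables 1 and 2. The primed copies
   below serve the terms outside the sum. *)
pose F s := stage_F K (nth 0 s 1).
pose x s := nth 0 s 2 * stage_len K (nth 0 s 1).
pose l s := stage_len K (nth 0 s 1).
pose Q s := cells_per_unit k (F s).
pose g (s : seq nat) := cell_card T k (F s) (x s) (l s).
pose N (s : seq nat) := cell_runs T k (F s) (x s) (l s).
have hF : recs 3 F by apply: recs_stage_F; solve_recs.
have hl : recs 3 l by apply: recs_stage_len; solve_recs.
have hx : recs 3 x by apply: recs_mul => //; solve_recs.
have hQ : recs 3 Q by apply: recs_mul => //; solve_recs.
have hg f : recs 3 f -> recs 3 (fun s => g s (f s)).
  by move=> hf; apply: recs_cell_card.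
have hN f : recs 3 f -> recs 3 (fun s => N s (f s)).
  by move=> hf; apply: recs_cell_runs.
pose h s := K ^ (K.-1 - nth 0 s 0) * K.+1 ^ (nth 0 s 0) *
  (2 ^ ((nth 0 s 1).*2 + K) * g s ((nth 0 s 1).*2 + nth 0 s 0)
   + 2 ^ (K.+1 - nth 0 s 0) * Q s * N s ((nth 0 s 1).*2 + nth 0 s 0)).
have hh : recs 3 h.
  by rewrite /h; solve_recs; (try (apply: hg; solve_recs)); apply: hN; solve_recs.
pose F' s := stage_F K (nth 0 s 0).
pose x' s := nth 0 s 1 * stage_len K (nth 0 s 0).
pose l' s := stage_len K (nth 0 s 0).
have hF' : recs 2 F' by apply: recs_stage_F; solve_recs.
have hl' : recs 2 l' by apply: recs_stage_len; solve_recs.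
have hx' : recs 2 x' by apply: recs_mul => //; solve_recs.
have hQ' : recs 2 (fun s => cells_per_unit k (F' s)) by apply: recs_mul => //; solve_recs.
have hs : recs 2 (fun s => (nth 0 s 0).*2 + K) by solve_recs.
have hgK := recs_cell_card hF' hx' hl' hs.
have hNK := recs_cell_runs hF' hx' hl' hs.
have hsum := recs_sum (recs_const 2 K) hh.
apply: recs_leq; last first.
  by apply: recs_mul hgK; solve_recs.
apply: recs_add; last by apply: recs_mul hQ'; solve_recs.
apply: recs_add; first by apply: recs_mul hsum; solve_recs.
by apply: recs_mul hNK; apply: recs_mul hQ'; solve_recs.
Qed.

Lemma recs_digits n f : recs n f -> recs n (fun s => digits T K (f s)).
Proof.
apply: (recs_comp1 (f := digits T K)).
apply: (recs_iteri
  (g := fun s => 2 * nth 0 s 1 + ~~ left_ok T K (nth 0 s 0).+1 (2 * nth 0 s 1))).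
- by solve_recs.
- by solve_recs.
by solve_recs; apply: recs_left_ok; solve_recs.
Qed.

End ComputableDigits.

(** * The potential *)

Local Open Scope classical_set_scope.
Local Open Scope ring_scope.

(** Throughout, K = k - 1, so this is 1 - 1/k. *)
Definition rho (K : nat) : rat := K%:R / K.+1%:R.

(** The term 2^(1-i) N, expressed in cells, of which there are [Q] per unit of length. *)
Definition penalty (Q i N : nat) : rat := 2 * Q%:R * N%:R / 2 ^+ i.

Definition potential (K Q s : nat) (g N : nat -> nat) : rat :=
  (g (s + K)%N)%:R
  - K.+1%:R^-1 * \sum_(i < K) rho K ^+ (K.-1 - i)
      * ((g (s + i)%N)%:R + penalty Q (s + i) (N (s + i)%N))
  - 2 / (K%:R - 1) * penalty Q (s + K) (N (s + K)%N).

Lemma rho_ge0 K : 0 <= rho K. Proof. by rewrite divr_ge0 ?ler0n. Qed.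

Lemma rho_le1 K : rho K <= 1.
Proof. by rewrite ler_pdivrMr ?ltr0n // mul1r ler_nat. Qed.

Lemma rhoE K : rho K = 1 - K.+1%:R^-1.
Proof. by rewrite /rho -[K%:R](addrK 1) natr1 mulrBl divff ?pnatr_eq0 // mul1r. Qed.

Lemma rho_ge56 K : (5 <= K)%N -> 5 / 6 <= rho K.
Proof.
move=> K5; rewrite rhoE.
have : (K.+1%:R : rat)^-1 <= 6^-1 by rewrite lef_pV2 ?posrE ?ltr0n // ler_nat.
by set q := K.+1%:R^-1; lra.
Qed.

Lemma penalty_ge0 Q i N : 0 <= penalty Q i N.
Proof. by rewrite divr_ge0 ?exprn_ge0 ?mulr_ge0 ?ler0n. Qed.

Lemma penaltyS Q i N : penalty Q i.+1 N = penalty Q i N / 2.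
Proof. by rewrite /penalty exprSr invfM mulrA. Qed.

(** Sliding the window discounts the old terms by [r], adds a new one of weight 1 and drops the
    oldest, of weight [r ^+ K]. *)
Lemma window_shift (r : rat) K (u : nat -> rat) s : (0 < K)%N ->
  \sum_(i < K) r ^+ (K.-1 - i) * u (s.+1 + i)%N =
  u (s + K)%N + r * \sum_(i < K) r ^+ (K.-1 - i) * u (s + i)%N - r ^+ K * u s.
Proof.
case: K => // K _ /=.
rewrite big_ord_recr /= subnn mul1r [in RHS]big_ord_recl /= addn0 subn0.
rewrite mulrDr mulrA -exprS addnS addSn [LHS]addrC.
have -> : \sum_(i < K) r ^+ (K - i) * u (s.+1 + i)%N =
  r * \sum_(i < K) r ^+ (K - bump 0 i) * u (s + bump 0 i)%N.
  rewrite mulr_sumr; apply: eq_bigr => i _; rewrite mulrA -exprS.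
  by rewrite /bump /= add1n addnS addSn -subSn ?subSS.
ring.
Qed.

(** The term dropped by the window releases rho^K u / (K+1). By the hypothesis on [a], this pays for
    the lost measure, (17/8) a u, and for the penalty of the new runs, 4 a u / (K-1). *)
Lemma potential_step (K Q s : nat) (a : rat) (g N : nat -> nat) :
  (5 <= K)%N ->
  let u := (g s)%:R + penalty Q s (N s) in
  let j := (s + K)%N in
  (17 / 8 + 4 / (K%:R - 1)) * a <= K.+1%:R^-1 * rho K ^+ K ->
  (g j)%:R <= (g j.+1)%:R + 17 / 8 * a * u ->
  penalty Q j.+1 (N j.+1) <= penalty Q j (N j) / 2 + 2 * a * u ->
  rho K * potential K Q s g N <= potential K Q s.+1 g N.
Proof.
move=> K5 u j ha hg hN; rewrite /potential.
have K1 : 0 < (K%:R - 1 : rat) by rewrite subr_gt0 ltr1n; lia.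
have K1' : 0 < (K.+1%:R : rat) by rewrite ltr0n.
rewrite (window_shift _ (fun i => (g i)%:R + penalty Q i (N i))); last lia.
rewrite -/u addSn -/j; set W := \sum_(i < K) _.
set lam := 2 / (K%:R - 1); set q := K.+1%:R^-1 in ha *.
have rE : rho K = 1 - q by exact: rhoE.
(* The weight 2/(K-1) is chosen to solve this equation: since old penalties are halved, the last
   term gains just what the penalty entering the window costs. *)
have lamE : lam * (rho K - 2^-1) = q.
  rewrite rE /lam /q -natr1; field.
  by rewrite nat1r !gt_eqF.
have lam0 : 0 <= lam by rewrite divr_ge0 // ltW.
have u0 : 0 <= u by rewrite addr_ge0 ?ler0n ?penalty_ge0.
have hN' := ler_wpM2l lam0 hN.
have hu := ler_wpM2r u0 ha.
have E4 : 4 / (K%:R - 1) = 2 * lam by rewrite /lam; field; rewrite gt_eqF.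
rewrite E4 in hu.
have p0 := penalty_ge0 Q j (N j).
set p := penalty Q j (N j) in hN' p0 *; set p' := penalty Q j.+1 _ in hN' *.
set G := (g j)%:R in hg *; set G' := (g j.+1)%:R in hg *.
set R := rho K ^+ K in hu *.
have -> : G' - q * (G + p + rho K * W - R * u) - lam * p' =
   (1 - q) * G - q * p - q * (rho K * W) + q * R * u - lam * p' + (G' - G) by ring.
have -> : rho K * (G - q * W - lam * p) =
  rho K * G - q * (rho K * W) - (lam * (rho K - 2^-1)) * p - lam * p / 2 by field.
rewrite lamE -rE.
have h2 : lam * p' <= lam * p / 2 + 2 * lam * a * u.
  by apply: le_trans hN' _; rewrite le_eqVlt; apply/orP; left; apply/eqP; ring.
have h3 : 17 / 8 * a * u + 2 * lam * a * u <= q * R * u.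
  by apply: le_trans hu; rewrite le_eqVlt; apply/orP; left; apply/eqP; ring.
lra.
Qed.

(** One extra run costs at most 2Q/2^s at each stage. The window has total weight at most 1 and so
    has the last term, whence twice this amount. *)
Lemma potential_add (K Q s : nat) (g N g1 N1 g2 N2 : nat -> nat) :
  (5 <= K)%N ->
  (forall i, g i = g1 i + g2 i)%N -> (forall i, N1 i + N2 i <= (N i).+1)%N ->
  potential K Q s g N - 4 * Q%:R / 2 ^+ s <=
    potential K Q s g1 N1 + potential K Q s g2 N2.
Proof.
move=> K5 hg hN; rewrite /potential.
have K1 : 4 <= (K%:R - 1 : rat).
  by rewrite -(@ler_nat rat) in K5; move: K5; lra.
have K1' : 0 < (K.+1%:R : rat) by rewrite ltr0n.
have s0 : 0 < (2 : rat) ^+ s by rewrite exprn_gt0.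
have pen i : penalty Q (s + i) (N1 (s + i)%N) + penalty Q (s + i) (N2 (s + i)%N) <=
  penalty Q (s + i) (N (s + i)%N) + 2 * Q%:R / 2 ^+ s.
  have h : penalty Q (s + i) (N1 (s + i)%N + N2 (s + i)%N) <=
    penalty Q (s + i) (N (s + i)%N).+1.
    rewrite /penalty ler_pM2r ?invr_gt0 ?exprn_gt0 //.
    by rewrite ler_wpM2l ?mulr_ge0 ?ler0n // ler_nat.
  have e : penalty Q (s + i) (N1 (s + i)%N + N2 (s + i)%N) =
    penalty Q (s + i) (N1 (s + i)%N) + penalty Q (s + i) (N2 (s + i)%N).
    by rewrite /penalty natrD mulrDr mulrDl.
  rewrite -e (le_trans h) // /penalty -(natr1 (N (s + i)%N)) mulrDr mulrDl mulr1 lerD2l.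
  rewrite ler_wpM2l ?mulr_ge0 ?ler0n // lef_pV2 ?posrE ?exprn_gt0 //.
  by rewrite ler_weXn2l ?ler1n ?leq_addr // ler1n.
set w := 2 * Q%:R / 2 ^+ s in pen.
have w0 : 0 <= w by rewrite divr_ge0 ?mulr_ge0 ?ler0n // ltW.
set lam := 2 / (K%:R - 1).
have lam1 : 0 <= lam <= 1 by rewrite divr_ge0 //= ?ler_pdivrMr; lra.
set q := K.+1%:R^-1; have q0 : 0 <= q by rewrite invr_ge0 ltW.
have sumW : \sum_(i < K) rho K ^+ (K.-1 - i)
      * ((g1 (s + i)%N)%:R + penalty Q (s + i) (N1 (s + i)%N)) +
   \sum_(i < K) rho K ^+ (K.-1 - i)
      * ((g2 (s + i)%N)%:R + penalty Q (s + i) (N2 (s + i)%N)) <=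
   \sum_(i < K) rho K ^+ (K.-1 - i)
      * ((g (s + i)%N)%:R + penalty Q (s + i) (N (s + i)%N)) + K%:R * w.
  have -> : K%:R * w = \sum_(i < K) w by rewrite sumr_const card_ord mulr_natl.
  rewrite -!big_split /=; apply: ler_sum => i _; rewrite -mulrDr hg natrD.
  set r := rho K ^+ _.
  have r01 : 0 <= r <= 1 by rewrite exprn_ge0 ?exprn_ile1 ?rho_ge0 ?rho_le1.
  have h := pen i; have := ler_wpM2l (proj1 (andP r01)) h.
  have : r * w <= w by rewrite ler_piMl //; case/andP: r01.
  lra.
have qK : q * K%:R <= 1 by rewrite mulrC ler_pdivrMr // mul1r ler_nat.
have sW := ler_wpM2l q0 sumW.
have := ler_wpM2l (proj1 (andP lam1)) (pen K).
have : lam * w <= w by rewrite ler_piMl //; case/andP: lam1.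
have : q * K%:R * w <= w by rewrite ler_piMl.
have -> : 4 * Q%:R / 2 ^+ s = 2 * w by rewrite /w; field; rewrite gt_eqF.
rewrite hg natrD; move: sW; lra.
Qed.

Lemma potential_scale (K Q r s : nat) (g N : nat -> nat) :
  potential K (r * Q) s (fun i => r * g i)%N N = r%:R * potential K Q s g N.
Proof.
rewrite /potential natrM.
have pE i M : penalty (r * Q) i M = r%:R * penalty Q i M.
  by rewrite /penalty natrM; ring.
rewrite pE; have -> : \sum_(i < K) rho K ^+ (K.-1 - i) *
    ((r * g (s + i))%N%:R + penalty (r * Q) (s + i) (N (s + i)%N)) =
  r%:R * \sum_(i < K) rho K ^+ (K.-1 - i) *
    ((g (s + i)%N)%:R + penalty Q (s + i) (N (s + i)%N)).
  by rewrite mulr_sumr; apply: eq_bigr => i _; rewrite pE natrM; ring.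
ring.
Qed.

Lemma eq_potential (K Q s : nat) (g N g' N' : nat -> nat) :
  (forall i, (i <= s + K)%N -> g i = g' i) -> (forall i, (i <= s + K)%N -> N i = N' i) ->
  potential K Q s g N = potential K Q s g' N'.
Proof.
move=> eg eN; rewrite /potential !eg // !eN //; congr (_ - _ * _ - _).
by apply: eq_bigr => i _; rewrite eg ?eN ?leq_add2l ?(ltnW (ltn_ord i)).
Qed.

Lemma potential_le (K Q s : nat) (g N : nat -> nat) : (5 <= K)%N ->
  potential K Q s g N <= (g (s + K)%N)%:R.
Proof.
move=> K5; rewrite /potential -addrA gerDl -opprD oppr_le0.
have K1 : 0 <= (K%:R - 1 : rat) by rewrite subr_ge0 ler1n; lia.
have h1 : 0 <= 2 / (K%:R - 1) * penalty Q (s + K) (N (s + K)%N).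
  exact: mulr_ge0 (divr_ge0 (ler0n _ 2) K1) (penalty_ge0 _ _ _).
have h2 : 0 <= \sum_(i < K) rho K ^+ (K.-1 - i) *
     ((g (s + i)%N)%:R + penalty Q (s + i) (N (s + i)%N)).
  apply: sumr_ge0 => i _; rewrite mulr_ge0 ?exprn_ge0 ?rho_ge0 //.
  by rewrite addr_ge0 ?ler0n ?penalty_ge0.
have h3 : 0 <= (K.+1%:R : rat)^-1 by rewrite invr_ge0 ler0n.
exact: addr_ge0 (mulr_ge0 h3 h2) h1.
Qed.

Lemma sum_rho K : \sum_(i < K) rho K ^+ (K.-1 - i) = K.+1%:R * (1 - rho K ^+ K).
Proof.
rewrite (reindex_inj rev_ord_inj) /=.
have -> : \sum_(i < K) rho K ^+ (K.-1 - (K - i.+1)) = \sum_(i < K) rho K ^+ i.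
  apply: eq_bigr => i _; congr (_ ^+ _); have := ltn_ord i; lia.
have := subrX1 (rho K) K; rewrite rhoE.
have K0 : K.+1%:R != 0 :> rat by rewrite pnatr_eq0.
set X := (1 - _) ^+ K; set S := \sum_(i < K) _ => h.
have -> : 1 - X = K.+1%:R^-1 * S by rewrite -[1 - X]opprB h; ring.
by rewrite mulrA divff // mul1r.
Qed.

(** The window weights add up to 1 - rho^K, so G free cells in one run leave about G rho^K minus two
    penalties of at most 2Q. As rho^K >= 2^-K, the length 2^(K+4) gives G rho^K >= 16 Q. *)
Lemma potential_start (K Q : nat) (g N : nat -> nat) : (5 <= K)%N ->
  (forall i, (i <= K)%N -> g i = 2 ^ (K + 4) * Q)%N ->
  (forall i, (i <= K)%N -> N i <= 1)%N ->
  8 * Q%:R <= potential K Q 0 g N.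
Proof.
move=> K5 hg hN; rewrite /potential !add0n hg //.
set G : rat := (2 ^ (K + 4) * Q)%:R.
have K1 : 4 <= (K%:R - 1 : rat) by rewrite -(@ler_nat rat) in K5; move: K5; lra.
have K1' : 0 < (K.+1%:R : rat) by rewrite ltr0n.
set w : rat := 2 * Q%:R; have w0 : 0 <= w by rewrite mulr_ge0.
have pen i : (i <= K)%N -> penalty Q i (N i) <= w.
  move=> iK; rewrite ler_pdivrMr ?exprn_gt0 // -/w ler_wpM2l //.
  rewrite (@le_trans _ _ 1) ?exprn_ege1 // ?ler1n //.
  by rewrite -[1]/(1%:R) ler_nat hN.
set lam := 2 / (K%:R - 1).
have lam1 : 0 <= lam <= 1 by rewrite divr_ge0 //= ?ler_pdivrMr; lra.
set q := K.+1%:R^-1; have q0 : 0 <= q by rewrite invr_ge0 ltW.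
set W := \sum_(i < K) _.
have sW : W <= (G + w) * (K.+1%:R * (1 - rho K ^+ K)).
  rewrite -sum_rho mulr_sumr; apply: ler_sum => i _.
  have iK := ltnW (ltn_ord i).
  by rewrite add0n mulrC ler_wpM2r ?exprn_ge0 ?rho_ge0 // hg // lerD2l pen.
have {}sW : q * W <= (G + w) * (1 - rho K ^+ K).
  have := ler_wpM2l q0 sW; rewrite [in X in X -> _]mulrCA.
  by rewrite (mulrA q) mulVf ?mul1r // gt_eqF.
have lw : lam * penalty Q K (N K) <= w.
  apply: le_trans (_ : 1 * penalty Q K (N K) <= _); last by rewrite mul1r pen.
  by rewrite ler_wpM2r ?penalty_ge0 //; case/andP: lam1.
set R := rho K ^+ K in sW.
have R0 : 0 <= R by rewrite exprn_ge0 // rho_ge0.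
have R2 : (2^-1) ^+ K <= R.
  by rewrite lerXn2r ?nnegrE ?rho_ge0 //; have := rho_ge56 K5; lra.
have G0 : 0 <= G by rewrite ler0n.
have GR : 8 * w <= G * R.
  apply: le_trans (ler_wpM2l G0 R2).
  rewrite /G natrM natrX exprD exprVn mulrAC (mulrC (2 ^+ K)) mulfK ?expf_neq0 //.
  rewrite /w; have : (0 : rat) <= Q%:R by [].
  have -> : (2 : rat) ^+ 4 = 16 by [].
  lra.
have wR : 0 <= w * R by rewrite mulr_ge0.
have -> : 8 * Q%:R = 4 * w by rewrite /w; ring.
lra.
Qed.

(** * The potential of the free cells of an interval *)

Definition cell_potential (T : pred nat) (K F x l s : nat) : rat :=
  potential K (cells_per_unit K.+1 F) s
    (cell_card T K.+1 F x l) (cell_runs T K.+1 F x l).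

Lemma ler_sum_block (T : pred nat) (k j M : nat) (f : nat -> nat) (c : rat) :
  0 <= c -> (block_card T k j <= M)%N ->
  (forall t, in_block k j t -> (f t)%:R <= c) ->
  (\sum_(0 <= t < (2 ^ j.+1).+1 | T t && in_block k j t) f t)%:R <= M%:R * c.
Proof.
move=> c0 hM hf; apply: (@le_trans _ _ ((block_card T k j)%:R * c)); last first.
  by rewrite ler_wpM2r // ler_nat.
rewrite /block_card !natr_sum big_distrl /= big_mkcond /=.
apply: ler_sum => t _; case: ifP => [/andP[_ bt]|_]; last by rewrite mul0r.
by rewrite mul1r hf.
Qed.

Lemma cell_potential_step (T : pred nat) (K F x l s M : nat) :
  (5 <= K)%N -> (0 < F)%N ->
  (forall t, 0 < t <= 2 ^ (s + K).+1 -> t %| F)%N ->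
  (block_card T K.+1 (s + K) <= M)%N ->
  (17 / 8 + 4 / (K%:R - 1)) * (M%:R / 2 ^+ K.+1) <= K.+1%:R^-1 * rho K ^+ K ->
  rho K * cell_potential T K F x l s <= cell_potential T K F x l s.+1.
Proof.
move=> K5 F0 hF hM hc.
pose Q := cells_per_unit K.+1 F.
pose u := (cell_card T K.+1 F x l s)%:R + penalty Q s (cell_runs T K.+1 F x l s).
set j := (s + K)%N in hF hM *.
have sj : (s <= j)%N by rewrite leq_addr.
have k2 : (1 < K.+1)%N by lia.
have Q0 : 0 < (Q%:R : rat) by rewrite ltr0n muln_gt0 expn_gt0.
have s0 : 0 < (2 : rat) ^+ s by rewrite exprn_gt0.
have k0 : 0 < (2 : rat) ^+ K.+1 by rewrite exprn_gt0.
have u0 : 0 <= u by rewrite addr_ge0 ?ler0n ?penalty_ge0.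
(* This is the purpose of the delay: each t removed at stage s + K has the size of 2^s up to a
   factor 2, so the period Q/t is at most 2Q/2^s and one [u] serves for all t of the block. *)
have tb t : in_block K.+1 j t -> (2 ^ s < 2 * t)%N /\ (t <= 2 ^ s)%N.
  rewrite /in_block /j -addnS !expnD => /andP[].
  rewrite leq_pmul2r ?expn_gt0 // expnS mulnA ltn_pmul2r ?expn_gt0 //; lia.
have ub t : in_block K.+1 j t ->
    (cell_card T K.+1 F x l s + Q %/ t * cell_runs T K.+1 F x l s)%:R <= u.
  move=> /tb[h1 h2]; rewrite natrD lerD2l natrM /penalty mulrAC ler_wpM2r ?ler0n //.
  rewrite ler_pdivlMr // -natrX -!natrM ler_nat.
  by have := leq_divM Q t; nia.
apply: (potential_step K5 hc); rewrite -/j -/u -/Q.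
- have := card_block_step T K.+1 F x l sj; rewrite -(ler_nat rat) natrD.
  move=> h; apply: (le_trans h); rewrite lerD2l.
  have c0 : 0 <= 17 / 8 / 2 ^+ K.+1 * u.
    exact: mulr_ge0 (divr_ge0 (divr_ge0 (ler0n _ 17) (ler0n _ 8)) (ltW k0)) u0.
  apply: (@le_trans _ _ (M%:R * (17 / 8 / 2 ^+ K.+1 * u))); last first.
    by rewrite le_eqVlt; apply/orP; left; apply/eqP; ring.
  apply: (ler_sum_block c0 hM) => t bt; have := bad_block_bound T s x l k2 F0 hF bt.
  rewrite -(ler_nat rat) !natrM natrX exprD => hb.
  have {}hb := le_trans hb (ler_wpM2l (ler0n rat 34) (ub t bt)).
  rewrite -(ler_pM2l k0) [leRHS]mulrA.
  have -> : 2 ^+ K.+1 * (17 / 8 / 2 ^+ K.+1) = 17 / 8 :> rat.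
    by field; rewrite expf_neq0.
  move: hb; have -> : (2 : rat) ^+ 4 = 16 by [].
  by rewrite mulrAC; lra.
- rewrite penaltyS.
  have := runs_block_step T x l sj k2 F0 hF; rewrite -/Q.
  set X := (\sum_(0 <= t < _ | _) _)%N => h.
  (* Each t creates at most u t / Q runs, and t <= 2^s. *)
  have X0 : X%:R <= M%:R * (2 ^+ s / Q%:R * u).
    apply: ler_sum_block => //; first by rewrite mulr_ge0 // divr_ge0 // ltW.
    move=> t bt; have := end_block_bound T s x l F0 hF bt.
    rewrite -/Q; set Y := (\sum_(0 <= d < l) _)%N => hY.
    have [t0 tQ] : (0 < t)%N /\ (t %| Q)%N.
      have t0 : (0 < t)%N by case/andP: bt => + _; case: (t).
      split=> //; apply: dvdn_mull; apply: hF; rewrite t0 /=.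
      by case/andP: bt => _; apply: leq_trans; rewrite leq_pmulr // expn_gt0.
    rewrite mulrAC ler_pdivlMr //.
    have -> : Y%:R * Q%:R = (Q %/ t * Y)%:R * t%:R :> rat.
      by rewrite -!natrM; congr (_%:R); rewrite -{1}(divnK tQ); ring.
    rewrite mulrC ler_pM ?ler0n //; first by rewrite -natrX ler_nat; case: (tb t bt).
    by apply: le_trans (ub t bt); rewrite ler_nat.
  have h' : (cell_runs T K.+1 F x l j.+1)%:R <=
     (cell_runs T K.+1 F x l j)%:R + M%:R * (2 ^+ s / Q%:R * u).
    by apply: le_trans (_ : (cell_runs T K.+1 F x l j)%:R + X%:R <= _);
      rewrite ?lerD2l // -natrD ler_nat.
  have w0 : 0 <= Q%:R / 2 ^+ j :> rat by rewrite divr_ge0 ?exprn_ge0 ?ler0n.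
  have := ler_wpM2l w0 h'; rewrite /penalty.
  have -> : Q%:R / 2 ^+ j * ((cell_runs T K.+1 F x l j)%:R +
      M%:R * (2 ^+ s / Q%:R * u)) =
    2 * Q%:R * (cell_runs T K.+1 F x l j)%:R / 2 ^+ j / 2
      + 2 * (M%:R / 2 ^+ K.+1) * u.
    rewrite /j exprD exprS; field.
    by rewrite !expf_neq0 //= gt_eqF.
  by apply: le_trans; rewrite le_eqVlt; apply/orP; left; apply/eqP; field; rewrite expf_neq0.
Qed.

(** The potential at [s] involves only stages up to [s + K], whose active t divide [F]; there
    refinement multiplies measures by [r] and keeps the runs. *)
Lemma cell_potential_scale (T : pred nat) (K F r x l s : nat) : (0 < r)%N -> ~~ T 0 ->
  (forall t, 0 < t <= 2 ^ (s + K) -> t %| F)%N ->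
  cell_potential T K (r * F) (r * x) (r * l) s = r%:R * cell_potential T K F x l s.
Proof.
move=> r0 T0 hF; rewrite /cell_potential -potential_scale.
have -> : cells_per_unit K.+1 (r * F) = (r * cells_per_unit K.+1 F)%N.
  by rewrite /cells_per_unit mulnCA.
have cE i d : (i <= s + K)%N ->
    cells T K.+1 (r * F) i (r * x) d = cells T K.+1 F i x (d %/ r)%N.
  move=> iK; rewrite /cells free_cell_scale //; last first.
    move=> t /andP[t0 ti]; apply: hF; rewrite t0 (leq_trans ti) //.
    by rewrite leq_exp2l.
  by congr free_cell; rewrite mulnC divnMDl.
apply: eq_potential => i iK.
  rewrite /cell_card -(card_below_scale _ _ r0); apply: eq_card_below => d; exact: cE.
rewrite /cell_runs -(runs_below_scale (cells T K.+1 F i x) l r0).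
apply: eq_runs_below => d; exact: cE.
Qed.

Lemma cell_potential_split (T : pred nat) (K F x l s : nat) : (5 <= K)%N ->
  cell_potential T K F x (l + l) s - 4 * (cells_per_unit K.+1 F)%:R / 2 ^+ s <=
  cell_potential T K F x l s + cell_potential T K F (x + l) l s.
Proof.
move=> K5.
have cE i : cells T K.+1 F i (x + l) =1 (fun d => cells T K.+1 F i x (l + d)).
  by move=> d; rewrite /cells addnA.
apply: potential_add => // i.
  by rewrite /cell_card card_below_add (eq_card_below _ (cE i)).
by rewrite /cell_runs (eq_runs_below _ (cE i)) runs_below_add.
Qed.

Lemma potential_testE (K Q s : nat) (g N : nat -> nat) : (5 <= K)%N ->
  potential_test K Q s g N = (8 * Q%:R / 2 ^+ s <= potential K Q s g N).
Proof.
move=> K5.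
have eK : (K.-1%:R : rat) = K%:R - 1 by case: K K5 => // K _; rewrite -natr1 addrK.
have K1 : 0 < (K%:R - 1 : rat) by rewrite -eK ltr0n; lia.
have K1' : 0 < (K.+1%:R : rat) by rewrite ltr0n.
(* A common denominator of all terms of the potential. *)
have c0 : 0 < (K%:R - 1) * K.+1%:R ^+ K * 2 ^+ (s + K) :> rat.
  by rewrite !mulr_gt0 ?exprn_gt0.
rewrite -(ler_pM2l c0) /potential_test -(ler_nat rat) !natrD !natrM !natrX eK.
have -> : (K%:R - 1) * K.+1%:R ^+ K * 2 ^+ (s + K) * potential K Q s g N =
 (K%:R - 1) * K.+1%:R ^+ K * 2 ^+ (s + K) * (g (s + K)%N)%:R -
 (K%:R - 1) * (\sum_(0 <= i < K) K ^ (K.-1 - i) * K.+1 ^ i *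
      (2 ^ (s + K) * g (s + i) + 2 ^ (K.+1 - i) * Q * N (s + i)))%N%:R
 - 4 * K.+1%:R ^+ K * Q%:R * (N (s + K)%N)%:R.
  rewrite /potential big_mkord.
  have -> : (\sum_(i < K) K ^ (K.-1 - i) * K.+1 ^ i *
      (2 ^ (s + K) * g (s + i) + 2 ^ (K.+1 - i) * Q * N (s + i)))%N%:R =
    K.+1%:R ^+ K * 2 ^+ (s + K) * (K.+1%:R^-1 * \sum_(i < K) rho K ^+ (K.-1 - i)
      * ((g (s + i)%N)%:R + penalty Q (s + i) (N (s + i)%N))) :> rat.
    rewrite !mulr_sumr natr_sum; apply: eq_bigr => i _.
    rewrite !(natrM, natrD, natrX) /rho /penalty expr_div_n.
    set m := (K.-1 - i)%N.
    have eKm : K = (m + i).+1 by rewrite /m; have := ltn_ord i; lia.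
    have -> : (K.+1%:R : rat) ^+ K = K.+1%:R * (K.+1%:R ^+ m * K.+1%:R ^+ i).
      by rewrite {2}eKm exprS exprD.
    have -> : (K.+1 - i)%N = m.+2 by rewrite {1}eKm; lia.
    have -> : (2 : rat) ^+ (s + K) = 2 ^+ s * (2 * (2 ^+ m * 2 ^+ i)).
      by rewrite exprD {1}eKm exprS exprD.
    rewrite (exprD _ s i) !exprS; field.
    by rewrite nat1r !expf_neq0 // gt_eqF.
  rewrite /penalty; field.
  by rewrite ?nat1r ?expf_neq0 ?gt_eqF.
have -> : (K%:R - 1) * K.+1%:R ^+ K * 2 ^+ (s + K) * (8 * Q%:R / 2 ^+ s) =
   (K%:R - 1) * K.+1%:R ^+ K * 2 ^+ (K + 3) * Q%:R :> rat.
  by rewrite !exprD; field; rewrite expf_neq0.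
by apply/idP/idP; lra.
Qed.

Lemma stage_fact_gt0 K n : (0 < stage_fact K n)%N. Proof. exact: fact_gt0. Qed.

Lemma stage_F_gt0 K n : (0 < stage_F K n)%N.
Proof. by rewrite muln_gt0 expn_gt0 fact_gt0. Qed.

Lemma dvdn_stage_F K n t : (0 < t <= 2 ^ (n.*2 + K))%N -> (t %| stage_F K n)%N.
Proof. by move=> h; apply/dvdn_mull/dvdn_fact. Qed.

Lemma left_okE (T : pred nat) (K n m : nat) : (5 <= K)%N ->
  left_ok T K n m =
  (8 * (cells_per_unit K.+1 (stage_F K n))%:R / 2 ^+ n.*2 <=
   cell_potential T K (stage_F K n) (m * stage_len K n) (stage_len K n) n.*2).
Proof. by move=> K5; rewrite /left_ok potential_testE. Qed.

(** With e = Q'/2^(2n) on the refined grid, the parent has potential at least 8e. Two steps leave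
    (5/6)^2 8e > 5e, and halving costs e. So if the left half is below the new threshold 2e, the
    right half is above it. *)
Lemma digits_invariant (T : pred nat) (K M n : nat) : (5 <= K)%N -> ~~ T 0 ->
  (forall j, block_card T K.+1 j <= M)%N ->
  (17 / 8 + 4 / (K%:R - 1)) * (M%:R / 2 ^+ K.+1) <= K.+1%:R^-1 * rho K ^+ K ->
  left_ok T K n (digits T K n).
Proof.
move=> K5 T0 hM hc; elim: n => [|n IH].
  (* Up to stage [K] no positive t is active, so the initial interval is a single run of free
     cells. *)
  have fr i d : (i <= K)%N -> cells T K.+1 (stage_F K 0) i 0 d.
    move=> iK; apply/free_cellP => t Tt ti.
    case: t Tt ti => [|t _]; first by rewrite (negPf T0).
    rewrite leqNgt (leq_trans _ (leq_pmull _ (ltn0Sn t))) //.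
    by rewrite ltn_exp2l // ltnS.
  rewrite left_okE // expr0 divr1 mul0n; apply: potential_start => // i iK.
    have -> : stage_len K 0 = (2 ^ (K + 4) * cells_per_unit K.+1 (stage_F K 0))%N.
      by rewrite /stage_len /cells_per_unit /stage_F expn0 mul1n mulnA.
    rewrite /cell_card /card_below.
    rewrite (eq_bigr (fun=> 1%N)) ?sum_nat_const_nat ?subn0 ?muln1 // => d _.
    by rewrite fr.
  rewrite /cell_runs /runs_below; case: (stage_len K 0) => [|l]; first by rewrite big_geq.
  rewrite big_nat_recl // big1 ?addn0 ?leq_b1 // => d _ /=.
  by rewrite !fr.
rewrite /digits iteriS -/(digits T K n); set m := digits T K n in IH *.
case h: (left_ok T K n.+1 (2 * m)%N); first by rewrite addn0.
rewrite addn1; move: h IH; rewrite !left_okE // doubleS.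
set s := n.*2; set F := stage_F K n; set F' := stage_F K n.+1.
set l := stage_len K n; set l' := stage_len K n.+1.
move=> /negbT; rewrite -ltNge => hleft hpar.
(* Refinement by [2 * q] turns the grid of stage [n] into that of stage [n.+1], and the old interval
   into exactly two new ones. *)
pose q := (stage_fact K n.+1 %/ stage_fact K n)%N.
have qE : stage_fact K n.+1 = (q * stage_fact K n)%N.
  rewrite divnK // /stage_fact.
  have le : (2 ^ (n.*2 + K) <= 2 ^ (n.+1.*2 + K))%N by rewrite leq_exp2l //; lia.
  by rewrite -(bin_fact le) dvdn_mull // dvdn_mulr.
have q0 : (0 < q)%N.
  by have := stage_fact_gt0 K n.+1; rewrite qE muln_gt0 => /andP[].
have FE : F' = (2 * q * F)%N by rewrite /F' /F /stage_F qE expnS; ring.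
have lE : (l' + l' = 2 * q * l)%N by rewrite /l' /l /stage_len qE; ring.
have r0 : (0 < 2 * q)%N by rewrite muln_gt0.
have hF t : (0 < t <= 2 ^ (s + K).+2)%N -> (t %| F')%N.
  by move=> ht; apply: dvdn_stage_F; rewrite doubleS.
have hF1 t : (0 < t <= 2 ^ (s + K).+1)%N -> (t %| F')%N.
  by case/andP => t0 ht; apply: hF; rewrite t0 (leq_trans ht) // leq_exp2l.
have F'0 : (0 < F')%N by exact: stage_F_gt0.
have p1 := cell_potential_step (2 * q * (m * l)) (l' + l') K5 F'0 hF1 (hM _) hc.
have p2 := cell_potential_step (s := s.+1) (2 * q * (m * l)) (l' + l') K5 F'0 hF (hM _) hc.
have psc : cell_potential T K F' (2 * q * (m * l)) (l' + l') s =
    (2 * q)%:R * cell_potential T K F (m * l) l s.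
  by rewrite FE lE cell_potential_scale // => t ht; apply: dvdn_stage_F.
have xE : (2 * q * (m * l) = 2 * m * l')%N by rewrite mulnCA -lE; ring.
have := cell_potential_split T F' (2 * m * l') l' s.+2 K5.
have -> : (2 * m * l' + l' = (2 * m).+1 * l')%N by ring.
move: p1 p2 psc hleft; rewrite xE.
set p0 := cell_potential _ _ _ _ _ s; set p := cell_potential _ _ _ _ _ s.+1.
set pp := cell_potential _ _ _ _ _ s.+2; set pl := cell_potential _ _ _ _ l' s.+2.
set pr := cell_potential _ _ _ _ l' s.+2; set pF := cell_potential _ _ _ _ _ s in hpar *.
move=> p1 p2 psc hleft hsplit.
set Q := cells_per_unit K.+1 F in hpar; set Q' := cells_per_unit K.+1 F' in hleft hsplit *.
have QE : (Q'%:R : rat) = (2 * q)%:R * Q%:R.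
  by rewrite -natrM; congr (_%:R); rewrite /Q' /Q /cells_per_unit FE; ring.
set e : rat := Q'%:R / 2 ^+ s.
have s0 : (2 : rat) ^+ s != 0 by rewrite expf_neq0.
have e0 : 0 <= e by rewrite divr_ge0 ?exprn_ge0 ?ler0n.
have ep0 : 8 * e <= p0.
  rewrite psc; apply: le_trans (ler_wpM2l (ler0n _ (2 * q)) hpar).
  by rewrite le_eqVlt; apply/orP; left; apply/eqP; rewrite /e QE; ring.
have e8 : 8 * Q'%:R / 2 ^+ s.+2 = 2 * e by rewrite /e !exprS; field.
have e4 : 4 * Q'%:R / 2 ^+ s.+2 = e by rewrite /e !exprS; field.
rewrite e8 in hleft *; rewrite e4 in hsplit.
have r56 := rho_ge56 K5; have r1 := rho_ge0 K.
have h1 : rho K * (8 * e) <= p by apply: le_trans p1; rewrite ler_wpM2l.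
have h2 : rho K * (rho K * (8 * e)) <= pp by apply: le_trans p2; rewrite ler_wpM2l.
have h3 : 5 / 6 * (5 / 6 * (8 * e)) <= rho K * (rho K * (8 * e)).
  have e8' : 0 <= 8 * e by lra.
  have h56 := ler_wpM2r e8' r56.
  have h56' : 0 <= 5 / 6 * (8 * e) by lra.
  exact: le_trans (ler_wpM2r h56' r56) (ler_wpM2l r1 h56).
lra.
Qed.

Lemma digits_free_cell (T : pred nat) (K M n : nat) : (5 <= K)%N -> ~~ T 0 ->
  (forall j, block_card T K.+1 j <= M)%N ->
  (17 / 8 + 4 / (K%:R - 1)) * (M%:R / 2 ^+ K.+1) <= K.+1%:R^-1 * rho K ^+ K ->
  exists2 c, (digits T K n * stage_len K n <= c <= (digits T K n).+1 * stage_len K n)%N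
    & free_cell T K.+1 (stage_F K n) (n.*2 + K) c.
Proof.
move=> K5 T0 hM hc; have := digits_invariant n K5 T0 hM hc.
rewrite left_okE // => h.
have pos : 0 < 8 * (cells_per_unit K.+1 (stage_F K n))%:R / 2 ^+ n.*2 :> rat.
  by rewrite divr_gt0 ?exprn_gt0 ?mulr_gt0 // ltr0n muln_gt0 expn_gt0 stage_F_gt0.
have := lt_le_trans pos (le_trans h (potential_le _ _ _ _ K5)).
set x := (digits T K n * _)%N; rewrite ltr0n => gt0.
have [/hasP[d]|/hasPn none] := boolP (has (cells T K.+1 (stage_F K n) (n.*2 + K) x)
                                       (iota 0 (stage_len K n))).
  by rewrite mem_iota add0n => /andP[_ dl] fd; exists (x + d)%N => //; rewrite mulSn; lia.
move: gt0; rewrite /cell_card /card_below big_nat big1 // => d dl.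
by rewrite (negPf (none d _)) // mem_iota add0n.
Qed.

(** * The limit point *)

Lemma distZ_ge (R : realType) (x e : R) :
  (forall z : int, e <= `|x - z%:~R|) -> e <= distZ x.
Proof.
move=> h; apply: lb_le_inf; first by exists `|x - 0%:~R|; exists 0.
by move=> _ [z _ <-].
Qed.

Lemma good_cell_dist (R : realType) (k F t c : nat) (z : int) : (0 < F)%N ->
  ~~ bad_cell k F t c ->
  17 / 2 ^+ (k + 4) <= `|t%:R * (c%:R / (cells_per_unit k F)%:R) - z%:~R| :> R.
Proof.
move=> F0; rewrite /bad_cell -leqNgt -/(cells_per_unit k F); set Q := cells_per_unit k F.
have Q0 : (0 < Q)%N by rewrite muln_gt0 expn_gt0.
move=> h; have := ltn_pmod (t * c + 17 * F) Q0; have := divn_eq (t * c + 17 * F) Q.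
move: h; set r := (_ %% Q)%N; set q := (_ %/ Q)%N => hr eq ltr.
have hz : (17 * F)%:Z <= `|(t * c)%:Z - z * Q%:Z|.
  (* With t c = q Q + r - 17 F and 34 F <= r < Q, the multiples of Q up to q Q lie at least 17 F
     below t c, and the others more than 17 F above. *)
  have [qz|qz] := lerP z q%:Z.
    have : 0 <= (q%:Z - z) * Q%:Z by rewrite mulr_ge0 ?subr_ge0.
    by lia.
  have : 0 <= (z - q%:Z - 1) * Q%:Z by rewrite mulr_ge0 //; lia.
  by lia.
have QR : 0 < (Q%:R : R) by rewrite ltr0n.
have -> : t%:R * (c%:R / Q%:R) - z%:~R = ((t * c)%:Z - z * Q%:Z)%:~R / Q%:R :> R.
  rewrite intrB intrM -!pmulrn (natrM _ t c); move: (Q%:R : R) QR => q' QR.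
  by field; rewrite gt_eqF.
rewrite normrM normfV (gtr0_norm QR) ler_pdivlMr // -intr_norm.
have -> : 17 / 2 ^+ (k + 4) * Q%:R = (17 * F)%:Z%:~R :> R.
  by rewrite -pmulrn /Q /cells_per_unit !natrM natrX; field; rewrite expf_neq0.
by rewrite ler_int.
Qed.

Section Theta.

Variables (R : realType) (T : pred nat) (K : nat).

Let scale (n : nat) : R := 2 ^+ (K + 4) / 2 ^+ n.
Let left_end (n : nat) : R := (digits T K n)%:R * scale n.

Let scaleS n : scale n = 2 * scale n.+1.
Proof. by rewrite /scale exprS; field; rewrite expf_neq0. Qed.

Let scale_gt0 n : 0 < scale n.
Proof. by rewrite divr_gt0 ?exprn_gt0. Qed.

Lemma digitsS n : exists b : bool, digits T K n.+1 = (2 * digits T K n + b)%N.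
Proof. by rewrite /digits iteriS; eexists. Qed.

Let left_end_mono n m : (n <= m)%N -> left_end n <= left_end m.
Proof.
move=> /subnK <-; elim: (m - n)%N => // i; move=> h; apply: (le_trans h).
rewrite addSn /left_end (scaleS (i + n)); have [b ->] := digitsS (i + n).
have : 0 <= b%:R * scale (i + n).+1 by rewrite mulr_ge0 ?ler0n // ltW.
by rewrite natrD natrM; lra.
Qed.

Let right_end_mono n m : (n <= m)%N -> left_end m + scale m <= left_end n + scale n.
Proof.
move=> /subnK <-; elim: (m - n)%N => // i; apply: le_trans.
rewrite addSn /left_end (scaleS (i + n)); have [b ->] := digitsS (i + n).
have sc := scale_gt0 (i + n).+1; rewrite natrD natrM.
have : b%:R * scale (i + n).+1 <= scale (i + n).+1.
  by apply: ler_piMl; [exact: ltW|rewrite lern1 leq_b1].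
lra.
Qed.

Lemma exists_limit : exists x : R, forall n,
  left_end n <= x <= left_end n + scale n.
Proof.
pose E := range left_end.
have ub n : ubound E (left_end n + scale n).
  move=> _ [m _ <-]; have [nm|mn] := leqP n m.
    by apply: le_trans (right_end_mono nm); rewrite lerDl ltW.
  by apply: le_trans (left_end_mono (ltnW mn)) _; rewrite lerDl ltW.
exists (sup E) => n; apply/andP; split.
  by apply: ub_le_sup; [exists (left_end 0 + scale 0)|exists n].
by apply: ge_sup; [exists (left_end n); exists n|].
Qed.

End Theta.

Lemma scale_cell (R : realType) (K n : nat) :
  (stage_len K n)%:R / (cells_per_unit K.+1 (stage_F K n))%:R =
  2 ^+ (K + 4) / 2 ^+ n :> R.
Proof.
rewrite /stage_len /cells_per_unit /stage_F !natrM !natrX; field.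
by rewrite !expf_neq0 // pnatr_eq0 -lt0n stage_fact_gt0.
Qed.

Lemma regular_of_digits (R : realType) (T : pred nat) (K M : nat) :
  (5 <= K)%N -> ~~ T 0 -> (forall j, block_card T K.+1 j <= M)%N ->
  (17 / 8 + 4 / (K%:R - 1)) * (M%:R / 2 ^+ K.+1) <= K.+1%:R^-1 * rho K ^+ K ->
  exists theta : R, [/\ 0 <= theta, theta <= 1,
    forall t, T t -> regular (2 ^- K.+1) t theta &
    recs 1 (fun s => T (nth 0%N s 0)) -> computable_real theta].
Proof.
move=> K5 T0 hM hc; have [x hx] := exists_limit R T K.
have x0 : 0 <= x.
  by have /andP[+ _] := hx 0%N; apply: le_trans; rewrite mul0r.
(* The limit [x] lies in an interval of length 2^(K+4); removing an integer preserves regularity. As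
   [m] is a fixed number, it is a constant in the computability proof. *)
pose m := Num.truncn x.
have /andP[mx xm] : m%:R <= x < m.+1%:R by apply: truncn_itv.
exists (x - m%:R); split.
- by rewrite subr_ge0.
- by rewrite lerBlDr addrC natr1 ltW.
- move=> t Tt; pose e : R := 2 ^- K.+1.
  have e0 : 0 < e by rewrite invr_gt0 exprn_gt0.
  (* Good cells guarantee (17/16) e, and approximating [x] by a grid point will cost e/32. What
     remains exceeds e by a fixed margin, so the infimum stays strictly above e. *)
  apply: (@lt_le_trans _ _ (33 / 32 * e)); first by rewrite -/e; lra.
  (* This [n] makes [t] active and, as t <= 2^t, makes t times the interval length at most e/32. *)
  apply: distZ_ge => z; pose n := (t + (K + 4) + K.+1 + 5)%N.
  have [c /andP[c1 c2] /free_cellP fc] := digits_free_cell n K5 T0 hM hc.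
  have tn : (t * 2 ^ K.+1 <= 2 ^ (n.*2 + K))%N.
    apply: (@leq_trans (2 ^ t * 2 ^ K.+1)); first by rewrite leq_mul2r ltnW ?orbT // ltn_expl.
    by rewrite -expnD leq_exp2l // /n; lia.
  have := good_cell_dist R (z + (t * m)%:Z) (stage_F_gt0 K n) (fc t Tt tn).
  set Q := cells_per_unit _ _; pose y : R := c%:R / Q%:R; rewrite -/y => hy.
  have Q0 : 0 < (Q%:R : R) by rewrite ltr0n muln_gt0 expn_gt0 stage_F_gt0.
  have yx : `|x - y| <= 2 ^+ (K + 4) / 2 ^+ n.
    have /andP[h1 h2] := hx n; rewrite -scale_cell -/Q in h1 h2 *.
    have h3 : (digits T K n)%:R * ((stage_len K n)%:R / Q%:R) <= y.
      by rewrite mulrA ler_pM2r ?invr_gt0 // -natrM ler_nat.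
    have h4 : y <= (digits T K n)%:R * ((stage_len K n)%:R / Q%:R) + (stage_len K n)%:R / Q%:R.
      by rewrite -[X in _ + X]mul1r -mulrDl natr1 mulrA ler_pM2r ?invr_gt0 // -natrM ler_nat.
    by rewrite ler_norml; apply/andP; split; lra.
  have tx : t%:R * `|x - y| <= e / 32.
    apply: (@le_trans _ _ (2 ^+ t * (2 ^+ (K + 4) / 2 ^+ n))).
      by rewrite ler_pM ?ler0n // -natrX ler_nat ltnW // ltn_expl.
    rewrite /e /n !exprD le_eqVlt; apply/orP; left; apply/eqP.
    by field; rewrite !expf_neq0.
  have -> : t%:R * (x - m%:R) - z%:~R =
     (t%:R * y - (z + (t * m)%:Z)%:~R) + t%:R * (x - y).
    by rewrite intrD -pmulrn natrM; ring.
  have := lerB_normD (t%:R * y - (z + (t * m)%:Z)%:~R) (t%:R * (x - y)).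
  rewrite (normrM t%:R (x - y)) normr_nat.
  have e17 : 17 / 2 ^+ (K.+1 + 4) = 17 / 16 * e :> R.
    by rewrite /e exprD; field; rewrite expf_neq0.
  by rewrite e17 in hy; lra.
- move=> recT.
  (* At index n + K + 4 the interval has length 2^-n. If the subtraction truncates to 0, then theta
     itself is at most 2^-n. *)
  pose a n := (digits T K (n + (K + 4)) - m * 2 ^ n)%N.
  exists (fun n => (a n)%:R / (2 ^ n)%:R).
    exists (fun=> 0%N), a, (fun n => 2 ^ n)%N; split.
    + by apply/computable_funE; exact: recs_const.
    + by apply/computable_funE; rewrite /a; solve_recs; apply: recs_digits => //; solve_recs.
    + by apply/computable_funE; solve_recs.
    by move=> n; rewrite expr0 mul1r -lt0n expn_gt0.
  move=> n; have /andP[] := hx (n + (K + 4))%N.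
  have n0 : 0 < (2 : R) ^+ n by rewrite exprn_gt0.
  have -> : 2 ^+ (K + 4) / 2 ^+ (n + (K + 4)) = 2 ^- n :> R.
    by rewrite (exprD _ n); field; rewrite !expf_neq0.
  rewrite fmorph_div !rmorph_nat natrX /a; set d := digits _ _ _ => h1 h2.
  have [le|lt] := leqP (m * 2 ^ n) d.
    rewrite natrB // natrM natrX mulrBl mulfK ?gt_eqF //.
    by rewrite ler_norml; apply/andP; split; lra.
  have -> : (d - m * 2 ^ n = 0)%N by apply/eqP; rewrite subn_eq0 ltnW.
  have hm : d%:R / 2 ^+ n <= m%:R :> R.
    by rewrite ler_pdivrMr // -natrX -natrM ler_nat ltnW.
  by rewrite mul0r ler_norml; apply/andP; split; lra.
Qed.

(** * From the hypotheses of the theorem to the numerical condition *)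

Lemma potential_rate (K M : nat) : (5 <= K)%N ->
  (3 * M * K.+1 ^ K.+1 <= 2 ^ K.+1 * K ^ K)%N ->
  (17 / 8 + 4 / (K%:R - 1)) * (M%:R / 2 ^+ K.+1) <= K.+1%:R^-1 * rho K ^+ K.
Proof.
move=> K5 h.
have E : K.+1%:R^-1 * rho K ^+ K = K%:R ^+ K / K.+1%:R ^+ K.+1.
  by rewrite /rho expr_div_n exprS; field; rewrite nat1r expf_neq0 ?pnatr_eq0.
(* For K >= 6 the coefficient is at most 17/8 + 4/5 < 3. For K = 5 it is 25/8 > 3, but then
   integrality forces M <= 1, which leaves enough room. *)
move: K5; rewrite leq_eqVlt => /predU1P[K5|K6].
  subst K; have {}h : (M <= 1)%N by move: h; rewrite !expnS !expn0; lia.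
  have M1 : M%:R <= 1 :> rat by rewrite lern1.
  rewrite E.
  have -> : (17 / 8 + 4 / (5%:R - 1)) * (M%:R / 2 ^+ 6) = 25 / 512 * M%:R :> rat by field.
  have -> : (5%:R : rat) ^+ 5 / 6%:R ^+ 6 = (5 / 6) ^+ 2 * (5 / 6) ^+ 2 * (5 / 6) / 6.
    by rewrite -exprD -exprSr; field.
  have h2 : 69 / 100 <= (5 / 6 : rat) ^+ 2 by rewrite expr2; lra.
  by nra.
have k0 : 0 < K.+1%:R ^+ K.+1 :> rat by rewrite exprn_gt0 // ltr0n.
have k2 : 0 < 2 ^+ K.+1 :> rat by rewrite exprn_gt0.
rewrite E (ler_pdivlMr _ _ k0).
apply: (@le_trans _ _ (3 * (M%:R / 2 ^+ K.+1) * K.+1%:R ^+ K.+1)).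
  apply: (ler_wpM2r (ltW k0)); apply: (ler_wpM2r (divr_ge0 (ler0n _ M) (ltW k2))).
  have K7 : 5 <= K%:R - 1 :> rat by rewrite lerBrDr natr1 ler_nat.
  have : 4 / (K%:R - 1) <= 4 / 5 :> rat.
    by rewrite ler_pM2l // lef_pV2 // posrE; lra.
  lra.
rewrite mulrA mulrAC (ler_pdivrMr _ _ k2) [leRHS]mulrC.
by rewrite -!natrX -!natrM ler_nat.
Qed.

(** Take the K-th power of 1 + 1/K <= exp(1/K). *)
Lemma expR1_ge (R : realType) (K : nat) : (0 < K)%N ->
  (K.+1%:R / K%:R) ^+ K <= expR 1 :> R.
Proof.
move=> K0; have KR : 0 < (K%:R : R) by rewrite ltr0n.
have -> : expR 1 = expR (K%:R^-1) ^+ K :> R.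
  by rewrite -expRM_natl mulfV ?gt_eqF.
rewrite lerXn2r ?nnegrE ?expR_ge0 ?divr_ge0 ?ler0n //.
by apply: le_trans (expR_ge1Dx _); rewrite -natr1 mulrDl mulfV ?gt_eqF // mul1r.
Qed.

Lemma block_card_le (R : realType) (T : set nat) (C : R) (k j : nat) :
  (#|` fset_set (T `&` dyadic_block R (j%:Z - k%:Z))|)%:R <= C ->
  (block_card (fun t => `[< T t >]) k j <= Num.truncn C)%N.
Proof.
move=> h; rewrite truncn_ge_nat; last exact: le_trans h.
apply: le_trans h; rewrite ler_nat /block_card.
have -> : (\sum_(0 <= t < (2 ^ j.+1).+1) (`[< T t >] && in_block k j t) =
  size [seq t <- index_iota 0 (2 ^ j.+1).+1 | `[< T t >] && in_block k j t])%N.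
  rewrite size_filter -sum1_count [RHS]big_mkcond; apply: eq_bigr => t _.
  by case: (_ && _).
apply: uniq_leq_size => [|t]; first by rewrite filter_uniq // iota_uniq.
have k0 : 0 < (2 : R) ^+ k by rewrite exprn_gt0.
have eb i : (2 : R) ^ (i%:Z - k%:Z) = 2 ^+ i / 2 ^+ k.
  by rewrite expfzDr ?pnatr_eq0 // exprnN.
have e1 : j%:Z - k%:Z + 1 = j.+1%:Z - k%:Z by lia.
rewrite mem_filter => /andP[/andP[/asboolP Tt /andP[h1 h2]] _].
(* Finiteness has to be checked, since [fset_set] sends infinite sets to the empty one. *)
rewrite in_fset_set; last first.
  apply: (@sub_finite_set _ _ `I_((2 ^ j.+1).+1)); last exact: finite_II.
  move=> i [_ /andP[_]]; rewrite e1 eb ler_pdivlMr // -!natrX -natrM ler_nat => hi.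
  by rewrite /= ltnS (leq_trans _ hi) // leq_pmulr // expn_gt0.
rewrite inE; split=> //; rewrite /dyadic_block /= e1 !eb.
by rewrite ltr_pdivrMr // ler_pdivlMr // -!natrX -!natrM ltr_nat ler_nat h1.
Qed.

Lemma block_card_gt0 (T : pred nat) (k t : nat) : (0 < k)%N -> (0 < t)%N -> T t ->
  exists j, (0 < block_card T k j)%N.
Proof.
move=> k0 t0 Tt; have n1 : (1 < t * 2 ^ k)%N.
  by rewrite (leq_trans (_ : 1 < 2 ^ k)%N) ?leq_pmull // -{1}(expn0 2) ltn_exp2l.
have /andP[h1 h2] := up_log_bounds (isT : (1 < 2)%N) n1.
exists (up_log 2 (t * 2 ^ k)).-1.
have e : (up_log 2 (t * 2 ^ k)).-1.+1 = up_log 2 (t * 2 ^ k).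
  by rewrite prednK // up_log_gt0 n1.
rewrite /block_card e.
have tl : (t < (2 ^ up_log 2 (t * 2 ^ k)).+1)%N.
  by rewrite ltnS (leq_trans _ h2) // leq_pmulr // expn_gt0.
apply: leq_trans (leq_sum_term _ tl); rewrite Tt /in_block e h2 andbT /=.
by rewrite h1.
Qed.

Theorem theorem8 (R : realType) (T : set nat) (C : R) (k : nat)
  (Tpos : forall t, T t -> (0 < t)%N)
  (TC : forall j : int, (#|` fset_set (T `&` dyadic_block R j)|)%:R <= C)
  (k_ge3 : (3 <= k)%N)
  (Ck : 3 * expR 1 * C * k%:R <= 2 ^+ k) :
  (exists theta : R,
     [/\ 0 <= theta, theta <= 1 &
         forall t, T t -> regular (2 ^- k) t theta]) /\
  (computable_set T ->
   exists theta : R,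
     [/\ computable_real theta, 0 <= theta, theta <= 1 &
         forall t, T t -> regular (2 ^- k) t theta]).
Proof.
pose Tb : pred nat := fun t => `[< T t >].
have C0 : 0 <= C by apply: le_trans (TC 0).
pose M := Num.truncn C.
have Tb0 : ~~ Tb 0%N by apply/asboolP => /Tpos.
have hM k' j : (block_card Tb k' j <= M)%N by exact: block_card_le.
suff [theta [th0 th1 reg comp]] : exists theta : R, [/\ 0 <= theta, theta <= 1,
    forall t, T t -> regular (2 ^- k) t theta &
    recs 1 (fun s => Tb (nth 0%N s 0)) -> computable_real theta].
  split; first by exists theta.
  by move=> /computable_funE cT; exists theta; split=> //; apply: comp.
(* If C < 1, every block and hence [T] is empty. Regularity is then vacuous, while [k] may be too
   small for the construction, which is run with K = 5. *)
have [M0|Mpos] := posnP M.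
  have Tempty t : ~ T t.
    move=> Tt; have [|||j] := @block_card_gt0 Tb k t; [by lia|exact: Tpos|exact/asboolP|].
    by have := hM k j; rewrite M0; lia.
  have hM0 j : (block_card Tb 6 j <= 0)%N by rewrite -M0.
  have rate0 : (3 * 0 * 6 ^ 6 <= 2 ^ 6 * 5 ^ 5)%N by rewrite muln0 mul0n.
  have [theta [th0 th1 _ comp]] :=
    regular_of_digits R (leqnn 5) Tb0 hM0 (potential_rate (leqnn 5) rate0).
  by exists theta; split=> // t /Tempty.
have MC : M%:R <= C by rewrite truncn_le.
case: k k_ge3 Ck => // K K2 Ck.
(* Replacing e by the smaller (1 + 1/K)^K and C by its integer part gives an inequality between
   integers. *)
have hK : (3 * M * K.+1 ^ K.+1 <= 2 ^ K.+1 * K ^ K)%N.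
  have KR : 0 < (K%:R : R) by rewrite ltr0n; lia.
  rewrite -(ler_nat R) !natrM !natrX -ler_pdivrMr ?exprn_gt0 //.
  apply: le_trans Ck.
  have -> : 3 * M%:R * K.+1%:R ^+ K.+1 / K%:R ^+ K =
    3 * (K.+1%:R / K%:R) ^+ K * M%:R * K.+1%:R :> R.
    by rewrite expr_div_n exprSr; field; rewrite expf_neq0 // gt_eqF.
  rewrite ler_wpM2r ?ler0n // ler_pM ?mulr_ge0 ?exprn_ge0 ?divr_ge0 ?ler0n //.
  by rewrite ler_wpM2l // expR1_ge //; lia.
(* For M >= 1 the integer inequality fails at K = 2, 3 and 4. *)
have K5 : (5 <= K)%N.
  by case: K K2 hK {Ck} => [|[|[|[|[|K]]]]] //; lia.
have [theta [th0 th1 reg comp]] :=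
  regular_of_digits R K5 Tb0 (hM K.+1) (potential_rate K5 hK).
by exists theta; split=> // t /asboolP; exact: reg.
Qed.
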